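(* Let $w\in W$ with length $n=\ell(w)\ge 1$. Then $\mathcal{B}_n=\{\mathcal{X}^\alpha : \alpha\in\{0,1\}^n\}$ is a linearly independent subset of $A_w$ (i.e. the family $(\mathcal{X}^\alpha)_{\alpha\in\{0,1\}^n}$ is linearly independent). In particular, $\dim_{\mathbb{C}} \mathcal{DL}_n=2^n$. Furthermore, $DL_n\cong \mathcal{DL}_n$ as $\mathbb{C}$-algebras.
   Context: **The algebra $DL_n$.** For a positive integer $n$, the Dot--Line algebra $DL_n$ is the associative unital $\mathbb{C}$-algebra generated by $X_1,\dots,X_n$ subject to $X_iX_j=X_jX_i$ for all $1\le i,j\le n$; $X_i^2=-2X_i\sum_{j=1}^{i-1}X_j$ for $2\le i\le n$; and $X_1^2=0$. **The algebra $A_w$.** $W=\langle s,t : s^2=t^2=e\rangle$ is the infinite dihedral group; every element has a unique reduced expression, an alternating word in the colors $s,t$. Let $\mathfrak{h}=\mathbb{C}\alpha_s^\vee\oplus\mathbb{C}\alpha_t^\vee$, and let $\alpha_s,\alpha_t\in\mathfrak{h}^*$ be given by $\alpha_s(\alpha_s^\vee)=2$, $\alpha_t(\alpha_s^\vee)=-2$, $\alpha_s(\alpha_t^\vee)=-2$, $\alpha_t(\alpha_t^\vee)=2$. $W$ acts on $\mathfrak{h}$ by $s(\alpha_s^\vee)=-\alpha_s^\vee$, $s(\alpha_t^\vee)=2\alpha_s^\vee+\alpha_t^\vee$, $t(\alpha_s^\vee)=\alpha_s^\vee+2\alpha_t^\vee$, $t(\alpha_t^\vee)=-\alpha_t^\vee$,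 on $\mathfrak{h}^*$ by the contragredient representation, and on the symmetric algebra $R=S(\mathfrak{h}^* )$, graded with $\deg\mathfrak{h}^*=2$, by algebra automorphisms. The Demazure operators are $\partial_c(f)=(f-c f)/\alpha_c$ for $c\in\{s,t\}$. An $S$-graph is a finite graph, with boundary properly embedded in the strip $\mathbb{R}\times[0,1]$, with edges colored by $s$ or $t$, whose vertices are univalent (dots, degree $+1$) or trivalent with all three edges of the same color (degree $-1$); its regions (connected components of the complement) may be decorated by boxes labeled by homogeneous $f\in R$ (boxes are linear in $f$ and boxes in the same region multiply). The degree of an $S$-graph is the sum of the degrees of its vertices and of the polynomials in its boxes. The algebra $A_w$ is the $\mathbb{C}$-vector space spanned by isotopy classes of $S$-graphs whose bottom and top boundary color sequences are both the reduced word of $w$, modulo the following local relations (for each color $c\in\{s,t\}$): (i) associativity: the two ways of joining two $c$-colored trivalent vertices by an edge in a four-valent configuration (the ''H'' and ''I'' graphs) are equal; (ii) unit: a $c$-colored trivalent vertex with one of its edges ending in a dot equals a plain $c$-colored edge; (iii) a $c$-colored edge with a dot at both ends (barbell) equals a box labeled $\alpha_c$; (iv) a vertical $c$-colored edge with box $f$ immediately on its left equals the edge with box $c(f)$ immediately on its right plus the broken edge (two dots, one on the lower and one on the upper end) with box $\partial_c(f)$; (v) needle: a $c$-colored trivalent vertex two of whose edges are joined to enclose an empty region is $0$; (vi) a diagram whose leftmost region is decorated by a homogeneous polynomial of positive degree is $0$. Multiplication is vertical concatenation. **The elements $\mathcal{X}^\alpha$.** For $\ell(w)=n$ and $1\le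 i\le n$, $\mathcal{X}_i\in A_w$ is the class of the diagram consisting of $n$ vertical strands colored by the reduced word of $w$ from left to right, in which all strands are unbroken except the $i$-th, which is broken: it is replaced by an edge from the bottom boundary ending in a dot and an edge from the top boundary ending in a dot. The $\mathcal{X}_i$ commute. For $\alpha=(\alpha_1,\dots,\alpha_n)\in(\mathbb{Z}_{\ge0})^n$ put $\mathcal{X}^\alpha=\prod_{i=1}^n\mathcal{X}_i^{\alpha_i}$. $\mathcal{DL}_n\subseteq A_w$ is the $\mathbb{C}$-span of $\mathcal{B}_n$ (it is a subalgebra of $A_w$). *)

(* Defs.v *)
From HB Require Import structures.
From mathcomp Require Import all_boot all_order all_algebra.
From mathcomp Require Import generic_quotient ring_quotient.
From mathcomp Require Import boolp.
From mathcomp Require Import monalg mpoly.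
From mathcomp Require Import ring.

Set Implicit Arguments.
Unset Strict Implicit.
Unset Printing Implicit Defensive.

Import GRing.Theory.
Local Open Scope ring_scope.
Local Open Scope quotient_scope.

(* monalg redefines this notation in type_scope as {malg T['X_{1..n}]}. *)
Local Notation "{ 'mpoly' T [ n ] }" := (mpoly n T) : type_scope.

Section Presented.
Variables (K : fieldType) (A : lalgType K) (rel : A -> A -> Prop).

Inductive rel_ideal : A -> Prop :=
| ideal_rel x y : rel x y -> rel_ideal (x - y)
| ideal_0 : rel_ideal 0
| ideal_add x y : rel_ideal x -> rel_ideal y -> rel_ideal (x + y)
| ideal_mull a x : rel_ideal x -> rel_ideal (a * x)
| ideal_mulr x a : rel_ideal x -> rel_ideal (x * a).

Definition rel_ideal_pred (x : A) : bool := `[< rel_ideal x >].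

Lemma rel_idealP x : reflect (rel_ideal x) (x \in rel_ideal_pred).
Proof. exact: asboolP. Qed.

Lemma rel_ideal_zmod_closed : zmod_closed rel_ideal_pred.
Proof.
split=> [|x y /rel_idealP hx /rel_idealP hy]; apply/rel_idealP.
  exact: ideal_0.
by apply: ideal_add => //; rewrite -mulN1r; apply: ideal_mull.
Qed.

HB.instance Definition _ :=
  GRing.isZmodClosed.Build A rel_ideal_pred rel_ideal_zmod_closed.

(* The relations are not known beforehand to be consistent, so the quotient is
   only a [pzRingType] (possibly 1 = 0) and a [lmodType], not an [algType].    *)
Definition rel_ideal_closed : zmodClosed A := GRing.ZmodClosed.clone A rel_ideal_pred _.
Definition presented : Type := Quotient.quot rel_ideal_closed.

HB.instance Definition _ := Choice.on presented.
HB.instance Definition _ := GRing.Zmodule.on presented.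
HB.instance Definition _ := EqQuotient.on presented.

Definition pres_class (x : A) : presented := \pi_presented x.

Lemma pres_classK (x : presented) : pres_class (repr x) = x.
Proof. exact: reprK. Qed.

Lemma pres_eqP (x y : A) :
  pres_class x = pres_class y <-> rel_ideal (x - y).
Proof.
split=> [/eqP|h].
  by rewrite -[_ == _](Quotient.idealrBE rel_ideal_closed) => /rel_idealP.
apply/eqP; rewrite -[_ == _](Quotient.idealrBE rel_ideal_closed).
exact/rel_idealP.
Qed.

Definition pres_one : presented := pres_class 1.
Definition pres_mul (x y : presented) : presented :=
  pres_class (repr x * repr y).
Definition pres_scale (a : K) (x : presented) : presented :=
  pres_class (a *: repr x).

Lemma pres_repr (x : A) : rel_ideal (repr (pres_class x) - x).
Proof. by apply/pres_eqP; rewrite pres_classK. Qed.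

Lemma pres_classM (x y : A) :
  pres_mul (pres_class x) (pres_class y) = pres_class (x * y).
Proof.
apply/pres_eqP; set x' := repr (pres_class x); set y' := repr (pres_class y).
rewrite (_ : _ - _ = (x' - x) * y' + x * (y' - y)).
  by apply: ideal_add; [apply: ideal_mulr|apply: ideal_mull]; apply: pres_repr.
by rewrite mulrBl mulrBr addrA subrK.
Qed.

Lemma pres_classZ a (x : A) : pres_scale a (pres_class x) = pres_class (a *: x).
Proof.
apply/pres_eqP; rewrite -scalerBr -[_ - _]mul1r scalerAl.
exact/ideal_mull/pres_repr.
Qed.

Lemma pres_classD (x y : A) :
  pres_class (x + y) = pres_class x + pres_class y.
Proof. exact: (@Quotient.pi_add _ rel_ideal_closed x y). Qed.

Lemma pres_ind (P : presented -> Prop) :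
  (forall x, P (pres_class x)) -> forall x, P x.
Proof. by move=> h x; rewrite -[x]pres_classK. Qed.

Fact pres_mulA : associative pres_mul.
Proof.
elim/pres_ind=> x; elim/pres_ind=> y; elim/pres_ind=> z.
by rewrite !pres_classM mulrA.
Qed.

Fact pres_mul1 : left_id pres_one pres_mul.
Proof. by elim/pres_ind=> x; rewrite pres_classM mul1r. Qed.

Fact pres_mulr1 : right_id pres_one pres_mul.
Proof. by elim/pres_ind=> x; rewrite pres_classM mulr1. Qed.

Fact pres_mulDl : left_distributive pres_mul +%R.
Proof.
elim/pres_ind=> x; elim/pres_ind=> y; elim/pres_ind=> z.
by rewrite -pres_classD !pres_classM mulrDl pres_classD.
Qed.

Fact pres_mulDr : right_distributive pres_mul +%R.
Proof.
elim/pres_ind=> x; elim/pres_ind=> y; elim/pres_ind=> z.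
by rewrite -pres_classD !pres_classM mulrDr pres_classD.
Qed.

HB.instance Definition _ := GRing.Zmodule_isPzRing.Build presented
  pres_mulA pres_mul1 pres_mulr1 pres_mulDl pres_mulDr.

Fact pres_scaleA a b x : pres_scale a (pres_scale b x) = pres_scale (a * b) x.
Proof. by elim/pres_ind: x => x; rewrite !pres_classZ scalerA. Qed.

Fact pres_scale1 : left_id 1 pres_scale.
Proof. by elim/pres_ind=> x; rewrite pres_classZ scale1r. Qed.

Fact pres_scaleDr : right_distributive pres_scale +%R.
Proof.
move=> a; elim/pres_ind=> x; elim/pres_ind=> y.
by rewrite -pres_classD !pres_classZ scalerDr pres_classD.
Qed.

Fact pres_scaleDl x : {morph pres_scale^~ x : a b / a + b}.
Proof.
by elim/pres_ind: x => x a b; rewrite !pres_classZ scalerDl pres_classD.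
Qed.

HB.instance Definition _ := GRing.Zmodule_isLmodule.Build K presented
  pres_scaleA pres_scale1 pres_scaleDr pres_scaleDl.

End Presented.

Section LinearAlgebra.
Variables (K : fieldType) (V : lmodType K).

Definition lin_indep (I : finType) (v : I -> V) : Prop :=
  forall a : I -> K, \sum_i a i *: v i = 0 -> forall i, a i = 0.

Definition in_span (I : finType) (v : I -> V) (x : V) : Prop :=
  exists a : I -> K, x = \sum_i a i *: v i.

Definition has_dim (U : V -> Prop) (d : nat) : Prop :=
  exists b : 'I_d -> V, lin_indep b /\ (forall x, U x <-> in_span b x).

End LinearAlgebra.

Variant color := cs | ct.

Definition bool_of_color c := if c is cs then true else false.
Definition color_of_bool b := if b then cs else ct.

Lemma bool_of_colorK : cancel bool_of_color color_of_bool.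
Proof. by case. Qed.

HB.instance Definition _ := Countable.copy color (can_type bool_of_colorK).
HB.instance Definition _ : isFinite color := CanIsFinite bool_of_colorK.

(* As the letters are involutions, the group < s, t : s^2 = t^2 = e > is the
   monoid of words modulo this congruence. *)
Inductive word_cong : seq color -> seq color -> Prop :=
| word_refl u : word_cong u u
| word_sym u v : word_cong u v -> word_cong v u
| word_trans u v w : word_cong u v -> word_cong v w -> word_cong u w
| word_cancel u c v : word_cong (u ++ [:: c; c] ++ v) (u ++ v).

Definition word_equiv : rel (seq color) := fun u v => `[< word_cong u v >].

Lemma word_equiv_class : equiv_class_of word_equiv.
Proof.
split=> [u|u v|v u w].
- by apply/asboolP; apply: word_refl.
- by apply/asboolP/asboolP => /word_sym.
by move=> /asboolP uv /asboolP vw; apply/asboolP/(word_trans uv vw).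
Qed.

Canonical word_equiv_rel := EquivRelPack word_equiv_class.

Definition W : Type := {eq_quot word_equiv}.

HB.instance Definition _ := Choice.on W.
HB.instance Definition _ := EqQuotient.on W.

Definition expressible (w : W) (n : nat) : bool :=
  [exists u : n.-tuple color, \pi_W (tval u) == w].

Lemma expressible_ex w : exists n, expressible w n.
Proof.
exists (size (repr w)); apply/existsP; exists (in_tuple (repr w)).
by rewrite /= reprK.
Qed.

Definition len (w : W) : nat := ex_minn (expressible_ex w).

Lemma len_expressible w : exists u : (len w).-tuple color, \pi_W (tval u) == w.
Proof. by rewrite /len; case: ex_minnP => n /existsP. Qed.

(* A word of minimal length representing w; in W it is the only one. *)
Definition red_word (w : W) : (len w).-tuple color := xchoose (len_expressible w).

Section Soergel.
Variable K : fieldType.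

(* R = S(h^* ) is {mpoly K[2]}, with h^* in polynomial degree 1 rather than 2.
   The variable 'X_(coord c) is the coordinate dual to the coroot of color c. *)
Definition coord (c : color) : 'I_2 := if c is cs then ord0 else ord_max.

(* The linear form with value phi c on the coroot of color c. *)
Definition form (phi : color -> K) : {mpoly K[2]} :=
  phi cs *: 'X_(coord cs) + phi ct *: 'X_(coord ct).

Definition simple_root (c : color) : {mpoly K[2]} :=
  form (fun e => if e == c then 2 else - 2).

(* Coefficient of the coroot of color e' in the image under c of the coroot of
   color e. *)
Definition coroot_act (c e e' : color) : K :=
  if e == c then (if e' == c then - 1 else 0)
  else (if e' == c then 2 else 1).

(* (c . x)(v) = x (c^-1 v) = x (c v), extended to R by substitution. *)
Definition act (c : color) (f : {mpoly K[2]}) : {mpoly K[2]} :=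
  f \mPo [tuple form (fun e => coroot_act c e cs);
                form (fun e => coroot_act c e ct)].

Lemma simple_root_dvd_coord c (i : 'I_2) :
  exists g, 'X_i - act c 'X_i == simple_root c * g.
Proof.
have [e ->] : exists e, i = coord e.
  by case: i => [[|[|//]] hi]; [exists cs|exists ct]; apply/val_inj.
exists (e == c)%:R; apply/eqP; rewrite /act comp_mpolyXU /simple_root /form.
case: c; case: e; rewrite /= /coroot_act /=
  ?(scaleNr, scale1r, scale0r, scaler_nat); ring.
Qed.

Lemma simple_root_dvd c (f : {mpoly K[2]}) : exists g, f - act c f == simple_root c * g.
Proof.
have hM p q : (exists g, p - act c p == simple_root c * g) ->
    (exists g, q - act c q == simple_root c * g) ->
    exists g, p * q - act c (p * q) == simple_root c * g.
  move=> [g /eqP hg] [h /eqP hh]; exists (g * q + act c p * h).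
  rewrite mulrDr mulrA -hg mulrCA -hh mulrBl mulrBr /act rmorphM /=.
  by rewrite addrA subrK.
elim/mpolyind: f => [|a m p _ _ [g /eqP hg]].
  by exists 0; rewrite /act rmorph0 subrr mulr0.
have [h /eqP hh] : exists h, 'X_[m] - act c 'X_[m] == simple_root c * h.
  rewrite mpolyXE_id; apply: (big_ind (fun x => exists h, x - act c x == simple_root c * h)).
  - by exists 0; rewrite /act rmorph1 subrr mulr0.
  - exact: hM.
  move=> i _; elim: (m i) => [|k ih].
    by exists 0; rewrite expr0 /act rmorph1 subrr mulr0.
  by rewrite exprS; apply: hM => //; apply: simple_root_dvd_coord.
exists (a *: h + g); rewrite mulrDr -scalerAr -hh -hg /act linearP /=.
by rewrite scalerBr opprD addrACA.
Qed.

(* The quotient (f - c f) / simple_root c, unique when 2 is invertible in K. *)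
Definition demazure (c : color) (f : {mpoly K[2]}) : {mpoly K[2]} :=
  xchoose (simple_root_dvd c f).

(* An S-graph in generic position is read from bottom to top as the list of its
   critical events: at each critical height there is exactly one vertex, local
   extremum of an edge, or box, and elsewhere the strands are vertical.         *)
Variant event :=
| EndDot of color
| StartDot of color
| Merge of color
| Split of color
| Cap of color
| Cup of color
| Box of {mpoly K[2]}.

Definition code_event (g : event) : 'I_6 * color + {mpoly K[2]} :=
  match g with
  | EndDot c => inl (inord 0, c)
  | StartDot c => inl (inord 1, c)
  | Merge c => inl (inord 2, c)
  | Split c => inl (inord 3, c)
  | Cap c => inl (inord 4, c)
  | Cup c => inl (inord 5, c)
  | Box f => inr f
  end.

Definition decode_event (x : 'I_6 * color + {mpoly K[2]}) : event :=
  match x with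
  | inl (i, c) =>
      match val i with
      | 0 => EndDot c
      | 1 => StartDot c
      | 2 => Merge c
      | 3 => Split c
      | 4 => Cap c
      | _ => Cup c
      end
  | inr f => Box f
  end.

Lemma code_eventK : cancel code_event decode_event.
Proof. by case=> //= c; rewrite inordK. Qed.

HB.instance Definition _ := Choice.copy event (can_type code_eventK).

Definition dom (g : event) : seq color :=
  match g with
  | EndDot c | Split c => [:: c]
  | Merge c | Cap c => [:: c; c]
  | StartDot _ | Cup _ | Box _ => [::]
  end.

Definition cod (g : event) : seq color :=
  match g with
  | StartDot c | Merge c => [:: c]
  | Split c | Cup c => [:: c; c]
  | EndDot _ | Cap _ | Box _ => [::]
  end.

Definition label_homog (g : event) : bool :=
  if g is Box f then f \is homog mdeg else true.

(* (l, g, r): the event g with strands l to its left and r to its right. *)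
Definition slice : Type := seq color * event * seq color.
Definition diagram : Type := seq slice.

Definition bottom (x : slice) : seq color := x.1.1 ++ dom x.1.2 ++ x.2.
Definition top (x : slice) : seq color := x.1.1 ++ cod x.1.2 ++ x.2.

Fixpoint is_graph (u v : seq color) (d : diagram) : bool :=
  if d is x :: d' then
    [&& u == bottom x, label_homog x.1.2 & is_graph (top x) v d']
  else u == v.

Definition whisker (l : seq color) (d : diagram) (r : seq color) : diagram :=
  [seq (l ++ x.1.1, x.1.2, x.2 ++ r) | x <- d].

(* Planar isotopy: events at different heights far from one another commute
   (in particular boxes move freely in their region), wiggles of an edge can be
   straightened, and univalent and trivalent vertices can be rotated. The other
   rotations, of StartDot and Merge, follow from these by straightening.        *)
Inductive isotopy : diagram -> diagram -> Prop :=
| iso_interchange g h m :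
    isotopy [:: ([::], g, m ++ dom h); (cod g ++ m, h, [::])]
            [:: (dom g ++ m, h, [::]); ([::], g, m ++ cod h)]
| iso_zigzag_l c :
    isotopy [:: ([::], Cup c, [:: c]); ([:: c], Cap c, [::])] [::]
| iso_zigzag_r c :
    isotopy [:: ([:: c], Cup c, [::]); ([::], Cap c, [:: c])] [::]
| iso_dot_l c :
    isotopy [:: ([::], StartDot c, [:: c]); ([::], Cap c, [::])]
            [:: ([::], EndDot c, [::])]
| iso_dot_r c :
    isotopy [:: ([:: c], StartDot c, [::]); ([::], Cap c, [::])]
            [:: ([::], EndDot c, [::])]
| iso_trivalent_l c :
    isotopy [:: ([::], Cup c, [:: c]); ([:: c], Merge c, [::])]
            [:: ([::], Split c, [::])]
| iso_trivalent_r c :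
    isotopy [:: ([:: c], Cup c, [::]); ([::], Merge c, [:: c])]
            [:: ([::], Split c, [::])].

(* [local_rel d [:: (a_1, d_1); ...; (a_k, d_k)]]: the diagram d equals
   a_1 d_1 + ... + a_k d_k. *)
Inductive local_rel : diagram -> seq (K * diagram) -> Prop :=
| rel_isotopy d d' : isotopy d d' -> local_rel d [:: (1, d')]
| rel_box_linear a f g :
    local_rel [:: ([::], Box (a *: f + g), [::])]
      [:: (a, [:: ([::], Box f, [::])]); (1, [:: ([::], Box g, [::])])]
| rel_box_mul f g :
    local_rel [:: ([::], Box f, [::]); ([::], Box g, [::])]
      [:: (1, [:: ([::], Box (f * g), [::])])]
| rel_box_one :
    local_rel [:: ([::], Box 1, [::])] [:: (1, [::])]
| rel_assoc c :
    local_rel [:: ([::], Merge c, [::]); ([::], Split c, [::])]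
      [:: (1, [:: ([::], Split c, [:: c]); ([:: c], Merge c, [::])])]
| rel_unit_l c :
    local_rel [:: ([::], Split c, [::]); ([::], EndDot c, [:: c])]
      [:: (1, [::])]
| rel_unit_r c :
    local_rel [:: ([::], Split c, [::]); ([:: c], EndDot c, [::])]
      [:: (1, [::])]
| rel_barbell c :
    local_rel [:: ([::], StartDot c, [::]); ([::], EndDot c, [::])]
      [:: (1, [:: ([::], Box (simple_root c), [::])])]
| rel_slide c f :
    local_rel [:: ([::], Box f, [:: c])]
      [:: (1, [:: ([:: c], Box (act c f), [::])]);
          (1, [:: ([::], EndDot c, [::]);
                  ([::], Box (demazure c f), [::]);
                  ([::], StartDot c, [::])])]
| rel_needle c :
    local_rel [:: ([::], Split c, [::]); ([::], Cap c, [::])] [::].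

Section Endomorphisms.
Variable u : seq color.

Record graph : Type := Graph { graph_val :> diagram; _ : is_graph u u graph_val }.

HB.instance Definition _ := [isSub for graph_val].
HB.instance Definition _ := [Choice of graph by <:].

Lemma graph_id_subproof : is_graph u u [::].
Proof. exact: eqxx. Qed.

Lemma is_graph_cat v1 v2 v3 d1 d2 :
  is_graph v1 v2 d1 -> is_graph v2 v3 d2 -> is_graph v1 v3 (d1 ++ d2).
Proof.
elim: d1 v1 => [|x d1 ih] v1 /=; first by move/eqP->.
by case/and3P=> -> -> h1 h2; rewrite /= ih.
Qed.

Definition graph_id : graph := Graph graph_id_subproof.
(* d2 is stacked on top of d1. *)
Definition graph_concat (d1 d2 : graph) : graph :=
  Graph (is_graph_cat (valP d1) (valP d2)).

Fact graph_concatA : associative graph_concat.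
Proof. by move=> x y z; apply/val_inj; rewrite /= catA. Qed.

Fact graph_concat1 : left_id graph_id graph_concat.
Proof. by move=> x; apply/val_inj. Qed.

Fact graph_concatr1 : right_id graph_id graph_concat.
Proof. by move=> x; apply/val_inj; rewrite /= cats0. Qed.

Fact graph_concat_unit x y :
  graph_concat x y = graph_id -> x = graph_id /\ y = graph_id.
Proof.
by move/(congr1 val); case: x y => [[|//] hx] [[|//] hy] _; split; apply/val_inj.
Qed.

HB.instance Definition _ := Choice_isMonomialDef.Build graph
  graph_concatA graph_concat1 graph_concatr1 graph_concat_unit.

(* Local relations hold inside any larger graph. In [graph_left] the box has no
   strand to its left, i.e. it lies in the leftmost region. *)
Inductive graph_rel : {malg K[graph]} -> {malg K[graph]} -> Prop :=
| graph_local pre post l r d ds (e : graph) (es : seq (K * graph)) :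
    local_rel d ds ->
    e = pre ++ whisker l d r ++ post :> diagram ->
    [seq (p.1, graph_val p.2) | p <- es] =
      [seq (p.1, pre ++ whisker l p.2 r ++ post) | p <- ds] ->
    graph_rel << e >> (\sum_(p <- es) p.1 *: << p.2 >>)
| graph_left pre post r k f (e : graph) :
    (0 < k)%N -> f \is k.-homog ->
    e = pre ++ ([::], Box f, r) :: post :> diagram ->
    graph_rel << e >> 0.

End Endomorphisms.

Definition Aw (w : W) := presented (@graph_rel (red_word w)).

HB.instance Definition _ w := GRing.PzRing.on (Aw w).
HB.instance Definition _ w := GRing.Lmodule.on (Aw w).

Definition broken (u : seq color) (i : nat) : diagram :=
  let c := nth cs u i in
  [:: (take i u, EndDot c, drop i.+1 u); (take i u, StartDot c, drop i.+1 u)].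

Lemma is_graph_broken u i : (i < size u)%N -> is_graph u u (broken u i).
Proof.
move=> hi; rewrite /= /bottom /top /= !eqxx /=.
by rewrite -drop_nth ?cat_take_drop ?eqxx.
Qed.

Lemma is_graph_Xgen w (i : 'I_(len w)) :
  is_graph (red_word w) (red_word w) (broken (red_word w) i).
Proof. by apply: is_graph_broken; rewrite size_tuple. Qed.

Definition Xgen (w : W) (i : 'I_(len w)) : Aw w :=
  pres_class (@graph_rel (red_word w)) << Graph (is_graph_Xgen i) >>.

Definition Xpow (w : W) (a : 'I_(len w) -> nat) : Aw w :=
  \prod_(i < len w) Xgen i ^+ a i.

Definition Bn (w : W) (a : {ffun 'I_(len w) -> bool}) : Aw w :=
  Xpow (fun i => nat_of_bool (a i)).

Definition DLsub (w : W) : Aw w -> Prop := in_span (@Bn w).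

Section DotLine.
Variable n : nat.

Definition dvar (i : 'I_n) : {malg K[{fmonom 'I_n}]} := << fmu i >>.

(* X_1, ..., X_n are indexed from 0. *)
Inductive DL_rel : {malg K[{fmonom 'I_n}]} -> {malg K[{fmonom 'I_n}]} -> Prop :=
| DL_comm i j : DL_rel (dvar i * dvar j) (dvar j * dvar i)
| DL_square (i : 'I_n) : (0 < i)%N ->
    DL_rel (dvar i ^+ 2) ((- 2) *: (dvar i * \sum_(j < n | (j < i)%N) dvar j))
| DL_square0 (i : 'I_n) : i = 0%N :> nat -> DL_rel (dvar i ^+ 2) 0.

Definition DL := presented DL_rel.

HB.instance Definition _ := GRing.PzRing.on DL.
HB.instance Definition _ := GRing.Lmodule.on DL.

End DotLine.

End Soergel.

(* Main.v *)
Require Import Defs.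
From HB Require Import structures.
From mathcomp Require Import all_boot all_order all_algebra.
From mathcomp Require Import generic_quotient.
From mathcomp Require Import finmap boolp monalg mpoly ring.
From mathcomp Require Import complex reals.

(* A_w acts on a model of C (x)_R BS(w), where BS(w) is the Bott-Samelson bimodule of w.
   Tensoring a right R-module N with R over R^c gives N + N d_c, with d_c = alpha_c / 2,
   so the model is obtained from C = R / R_+ by doubling once for each letter of w.
   The broken line in position i acts as (a, b) |-> ((a + b d_c) d_c, a + b d_c) on the
   i-th doubling, and reading off the two components of the last doubling proves by
   induction on w that the images of 1 under the products of distinct broken lines are
   linearly independent.
   In A_w itself, X_i^2 contains a barbell alpha_c between strands i - 1 and i + 1. As
   alpha_s = - alpha_t, sliding it to the left through a strand reproduces the root of the
   next colour and a term - 2 X_j, and it vanishes on the far left.  Hence DL_n maps to A_w;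
   square-free monomials span DL_n and have independent images, so this map is injective. *)

Set Implicit Arguments.
Unset Strict Implicit.
Unset Printing Implicit Defensive.

Import GRing.Theory Num.Theory.
Local Open Scope ring_scope.
Local Open Scope quotient_scope.

(* monalg redefines this notation. *)
Local Notation "{ 'mpoly' T [ n ] }" := (mpoly n T) : type_scope.

(** * Demazure operators *)

Section Demazure.
Variable K : numFieldType.
Implicit Types (c : color) (f g : {mpoly K[2]}).

Lemma simple_rootE c :
  simple_root K c = (if c is cs then 2 else - 2) *: ('X_ord0 - 'X_ord_max).
Proof.
rewrite /simple_root /Defs.form; case: c => /=; rewrite scalerBr.
  by rewrite !scaleNr.
by rewrite !scaleNr opprK.
Qed.

(** The rows of the Cartan matrix are opposite, so the two simple roots are linearly dependent. This
    sign is what turns a reflected root into the root of the other colour. *)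
Lemma simple_root_neq c d : c != d -> simple_root K c = - simple_root K d.
Proof. by rewrite !simple_rootE; case: c; case: d => // _; rewrite ?scaleNr ?opprK. Qed.

Lemma simple_root_homog c : simple_root K c \is 1.-homog.
Proof. by rewrite simple_rootE; apply/rpredZ/rpredB; rewrite dhomogX; apply/eqP/mdeg1. Qed.

Lemma simple_root_neq0 c : simple_root K c != 0.
Proof.
rewrite simple_rootE scaler_eq0 negb_or; apply/andP; split.
  by case: c; rewrite ?oppr_eq0 pnatr_eq0.
apply/eqP => /mpolyP /(_ U_(ord0)%MM).
rewrite mcoeffB !mcoeffX mcoeff0 eqxx.
have -> : (U_(ord_max) == U_(ord0) :> 'X_{1..2})%MM = false.
  by apply/eqP => /(congr1 (fun m : 'X_{1..2} => m ord0)); rewrite !mnmE.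
by move/eqP; rewrite subr0 oner_eq0.
Qed.

Lemma act_is_linear c : linear (@act K c).
Proof. by move=> a f g; rewrite /act linearP. Qed.

Lemma act_is_monoid_morphism c : GRing.monoid_morphism (@act K c).
Proof. by split=> [|f g]; rewrite /act ?rmorph1 ?rmorphM. Qed.

HB.instance Definition _ c :=
  GRing.isLinear.Build K {mpoly K[2]} {mpoly K[2]} *:%R (@act K c) (act_is_linear c).
HB.instance Definition _ c :=
  GRing.isMonoidMorphism.Build {mpoly K[2]} {mpoly K[2]} (@act K c) (act_is_monoid_morphism c).

Lemma act_simple_root c : act c (simple_root K c) = - simple_root K c.
Proof.
rewrite simple_rootE /act linearZ rmorphB /= !comp_mpolyXU /= /Defs.form /coroot_act.
by case: c => /=; rewrite ?(scaleNr, scale1r, scale0r, scaler_nat); ring.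
Qed.

Lemma act_coord c d : act c ('X_(Defs.coord d) : {mpoly K[2]}) =
  'X_(Defs.coord d) - (if d == c then simple_root K c else 0).
Proof.
rewrite simple_rootE /act comp_mpolyXU.
case: c; case: d; rewrite /= /Defs.form /coroot_act /=
  ?(scaleNr, scale1r, scale0r, scaler_nat); ring.
Qed.

Lemma actK c : involutive (act (K := K) c).
Proof.
have actX (i : 'I_2) : act c (act c ('X_i : {mpoly K[2]})) = 'X_i.
  have [d ->] : exists d, i = Defs.coord d.
    by case: i => [[|[|//]] hi]; [exists cs|exists ct]; apply/val_inj.
  rewrite act_coord rmorphB /= act_coord.
  by case: ifP => _; rewrite ?act_simple_root ?rmorph0; ring.
move=> f; elim/mpolyind: f => [|a m p _ _ ih]; first by rewrite !rmorph0.
rewrite !linearP /= ih; congr (_ *: _ + _).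
rewrite mpolyXE_id !rmorph_prod; apply: eq_bigr => i _.
by rewrite !rmorphXn /= actX.
Qed.

Lemma demazureE c f : simple_root K c * demazure c f = f - act c f.
Proof. exact/esym/eqP/(xchooseP (simple_root_dvd c f)). Qed.

(** [demazure] comes from a choice; as R is a domain and the root is nonzero, its defining equation
    determines it. The identities below are verified through that equation. *)
Lemma demazure_uniq c f g : simple_root K c * g = f - act c f -> demazure c f = g.
Proof. by rewrite -demazureE => /(mulfI (simple_root_neq0 c)). Qed.

Lemma demazure_is_linear c : linear (@demazure K c).
Proof.
move=> a f g; apply: demazure_uniq.
by rewrite mulrDr -scalerAr !demazureE linearP /= scalerBr opprD addrACA.
Qed.

HB.instance Definition _ c :=
  GRing.isLinear.Build K {mpoly K[2]} {mpoly K[2]} *:%R (@demazure K c) (demazure_is_linear c).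

Lemma demazureD c f g : demazure c (f + g) = demazure c f + demazure c g.
Proof. exact: linearD. Qed.

Lemma demazureZ c a f : demazure c (a *: f) = a *: demazure c f.
Proof. exact: linearZ. Qed.

Lemma demazure_act c f : demazure c (act c f) = - demazure c f.
Proof. by apply: demazure_uniq; rewrite actK mulrN demazureE opprB. Qed.

Lemma demazure_simple_root c : demazure c (simple_root K c) = 2.
Proof. by apply: demazure_uniq; rewrite act_simple_root; ring. Qed.

Lemma demazure1 c : demazure c (1 : {mpoly K[2]}) = 0.
Proof. by apply: demazure_uniq; rewrite rmorph1 mulr0 subrr. Qed.

(** Normalised so that its Demazure derivative is 1; then 1 and [half_root c] form a basis of R over
    the invariants R^c. *)
Definition half_root c : {mpoly K[2]} := 2^-1 *: simple_root K c.

Lemma half_rootD c : half_root c + half_root c = simple_root K c.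
Proof.
by rewrite -scalerDl (_ : 2^-1 + 2^-1 = 1) ?scale1r //; field.
Qed.

(** The coefficient of 1 in the decomposition R = R^c + d_c R^c; the coefficient of d_c is
    [demazure c f]. *)
Definition inv_part c f := f - half_root c * demazure c f.

Lemma inv_part_is_linear c : linear (inv_part c).
Proof. by move=> a f g; rewrite /inv_part linearP /= scalerBr mulrDr -scalerAr opprD addrACA. Qed.

HB.instance Definition _ c :=
  GRing.isLinear.Build K {mpoly K[2]} {mpoly K[2]} *:%R (inv_part c) (inv_part_is_linear c).

Lemma inv_partD c f g : inv_part c (f + g) = inv_part c f + inv_part c g.
Proof. exact: linearD. Qed.

Lemma inv_partZ c a f : inv_part c (a *: f) = a *: inv_part c f.
Proof. exact: linearZ. Qed.

Lemma inv_part_decomp c f : f = inv_part c f + half_root c * demazure c f.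
Proof. by rewrite subrK. Qed.

Lemma actE c f : act c f = f - (half_root c + half_root c) * demazure c f.
Proof. by rewrite half_rootD demazureE; ring. Qed.

(** The d_c-coefficient of (a + d_c b)(a' + d_c b'), where d_c^2 is invariant; [inv_partM] is the
    other coefficient. *)
Lemma demazureM c f g :
  demazure c (f * g) = inv_part c f * demazure c g + demazure c f * inv_part c g.
Proof.
apply: demazure_uniq; rewrite rmorphM /= !actE -!half_rootD.
rewrite /inv_part; move: (half_root c) (demazure c f) (demazure c g) => h x y; ring.
Qed.

Lemma inv_partM c f g : inv_part c (f * g) =
  inv_part c f * inv_part c g + demazure c f * demazure c g * half_root c ^+ 2.
Proof.
rewrite {1}/inv_part demazureM {1}(inv_part_decomp c f) {1}(inv_part_decomp c g).
move: (half_root c) (demazure c f) (demazure c g) (inv_part c f) (inv_part c g).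
by move=> h x y u v; ring.
Qed.

Lemma inv_part_act c f : inv_part c (act c f) = inv_part c f.
Proof.
rewrite /inv_part demazure_act actE.
by move: (half_root c) (demazure c f) => h x; ring.
Qed.

Lemma inv_part1 c : inv_part c 1 = 1.
Proof. by rewrite /inv_part demazure1 mulr0 subr0. Qed.

Lemma demazure_half_root c : demazure c (half_root c) = 1.
Proof.
by rewrite linearZ /= demazure_simple_root -scaler_nat scalerA mulVf ?scale1r ?pnatr_eq0.
Qed.

Lemma inv_part_half_root c : inv_part c (half_root c) = 0.
Proof. by rewrite /inv_part demazure_half_root mulr1 subrr. Qed.

(** Both f - c f and the root change sign under c, so their quotient is fixed. *)
Lemma act_demazure c f : act c (demazure c f) = demazure c f.
Proof.
apply: (mulfI (simple_root_neq0 c)); rewrite demazureE.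
rewrite -{1}[simple_root K c]opprK -act_simple_root mulNr -rmorphM /= demazureE.
by rewrite rmorphB /= actK opprB.
Qed.

Lemma demazureK c f : demazure c (demazure c f) = 0.
Proof. by apply: demazure_uniq; rewrite act_demazure subrr mulr0. Qed.

Lemma inv_part_id c f : demazure c f = 0 -> inv_part c f = f.
Proof. by rewrite /inv_part => ->; rewrite mulr0 subr0. Qed.

Lemma demazure_inv_part c f : demazure c (inv_part c f) = 0.
Proof.
apply: demazure_uniq; rewrite mulr0 {2}/inv_part rmorphB rmorphM /= act_demazure.
rewrite linearZ /= act_simple_root scalerN -/(half_root c) actE /inv_part.
by move: (half_root c) (demazure c f) => h x; ring.
Qed.

Lemma demazure_half_root_sqr c f :
  demazure c f = 0 -> demazure c (f * half_root c ^+ 2) = 0.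
Proof.
move=> hf; rewrite demazureM hf mul0r addr0 expr2 demazureM inv_part_half_root.
by rewrite mul0r mulr0 addr0 mulr0.
Qed.

End Demazure.

(** * An action of diagrams *)

Section Glue.
Variable K : nzRingType.
Implicit Types p q : {poly K}.

(* Identifies {poly K} with two copies of itself, so that all words share one model space. *)
Definition glue p q : {poly K} := p \Po 'X^2 + (q \Po 'X^2) * 'X.

Lemma even_glue p q : even_poly (glue p q) = p.
Proof.
apply/polyP => i; rewrite coef_even_poly coefD coefMX !coef_comp_poly_Xn //.
rewrite dvdn2 odd_double divn2 doubleK; case: i => [|i]; rewrite ?addr0 //=.
by rewrite dvdn2 /= odd_double addr0.
Qed.

Lemma odd_glue p q : odd_poly (glue p q) = q.
Proof.
apply/polyP => i; rewrite coef_odd_poly coefD coefMX !coef_comp_poly_Xn //=.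
by rewrite !dvdn2 /= odd_double add0r divn2 doubleK.
Qed.

Lemma glue_even_odd p : glue (even_poly p) (odd_poly p) = p.
Proof. exact: poly_even_odd. Qed.

Lemma glueP p q : even_poly p = even_poly q -> odd_poly p = odd_poly q -> p = q.
Proof. by move=> e o; rewrite -(glue_even_odd p) e o glue_even_odd. Qed.

Lemma glueD p q p' q' : glue p q + glue p' q' = glue (p + p') (q + q').
Proof. by apply: glueP; rewrite linearD /= !(even_glue, odd_glue). Qed.

Lemma glueZ a p q : a *: glue p q = glue (a *: p) (a *: q).
Proof. by apply: glueP; rewrite linearZ /= !(even_glue, odd_glue). Qed.

Lemma glue00 : glue 0 0 = 0.
Proof. by apply: glueP; rewrite ?even_glue ?odd_glue linear0. Qed.

Lemma glue10 : glue 1 0 = 1.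
Proof. by apply: glueP; rewrite ?even_glue ?odd_glue -polyC1 ?even_polyC ?odd_polyC. Qed.

Definition glueE := (even_glue, odd_glue).

End Glue.

(** * Operators of events and diagrams on the model, and soundness of the local relations *)

Section Representation.
Variable K : numFieldType.
Local Notation R := {mpoly K[2]}.
Local Notation E := {poly K}.
Implicit Types (c : color) (f g : R) (L : seq color) (v : E).

(* Right action of R on the model attached to the reversed word L.  The model C (x)_R BS(rev L)
   is encoded in {poly K}: N (x)_{R^c} R = N + N d_c is glue N N, with d_c = half_root c, and
   f = inv_part c f + d_c * demazure c f with R^c-coefficients. *)
Fixpoint ract L f v : E :=
  if L is c :: L' then
    glue (ract L' (inv_part c f) (even_poly v)
          + ract L' (demazure c f * half_root K c ^+ 2) (odd_poly v))
         (ract L' (demazure c f) (even_poly v) + ract L' (inv_part c f) (odd_poly v))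
  else f@_0%MM *: v.

Lemma ract_is_linear L f : linear (ract L f).
Proof.
elim: L f => [|c L ih] f a u v /=; first by rewrite scalerDr !scalerA mulrC.
by rewrite glueZ glueD !linearP /= !ih !scalerDr; congr glue; rewrite addrACA.
Qed.

HB.instance Definition _ L f := GRing.isLinear.Build K E E *:%R (ract L f) (ract_is_linear L f).

Lemma ractDl L f g v : ract L (f + g) v = ract L f v + ract L g v.
Proof.
elim: L f g v => [|c L ih] f g v /=; first by rewrite mcoeffD scalerDl.
rewrite inv_partD demazureD mulrDl.
move: (inv_part c f) (inv_part c g) (demazure c f) (demazure c g) (half_root K c ^+ 2).
move=> f1 g1 f2 g2 h; rewrite (ih f1 g1) (ih f2 g2) (ih (f2 * h)) (ih f1 g1) glueD.
by congr glue; rewrite addrACA.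
Qed.

Lemma ractDr L f u v : ract L f (u + v) = ract L f u + ract L f v.
Proof. exact: linearD. Qed.

Lemma ractZl L a f v : ract L (a *: f) v = a *: ract L f v.
Proof.
elim: L f v => [|c L ih] f v /=; first by rewrite mcoeffZ scalerA.
rewrite inv_partZ demazureZ -scalerAl.
move: (inv_part c f) (demazure c f) (half_root K c ^+ 2) => f1 f2 h.
by rewrite !(ih f1) !(ih f2) (ih (f2 * h)) glueZ !scalerDr.
Qed.

Lemma ract0l L v : ract L 0 v = 0.
Proof. by rewrite -(scale0r (0 : R)) ractZl scale0r. Qed.

Lemma ract1 L v : ract L 1 v = v.
Proof.
elim: L v => [|c L ih] v /=; first by rewrite mcoeff1 eqxx scale1r.
by rewrite inv_part1 demazure1 mul0r !ract0l !ih add0r addr0 glue_even_odd.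
Qed.

Lemma ractM L f g v : ract L (f * g) v = ract L f (ract L g v).
Proof.
elim: L f g v => [|c L ih] f g v /=.
  by rewrite scalerA; congr (_ *: _); rewrite rmorphM.
rewrite inv_partM demazureM !glueE.
move: (inv_part c f) (inv_part c g) (demazure c f) (demazure c g) (half_root K c ^+ 2).
move=> a a' b b' h; rewrite !ractDr -!ih; congr glue; rewrite addrACA -!ractDl.
  by congr (ract L _ _ + ract L _ _); ring.
by congr (ract L _ _ + ract L _ _); ring.
Qed.

Lemma ractC L f g v : ract L f (ract L g v) = ract L g (ract L f v).
Proof. by rewrite -!ractM mulrC. Qed.

Lemma ract_half_root c L v : ract (c :: L) (half_root K c) v =
  glue (ract L (half_root K c ^+ 2) (odd_poly v)) (even_poly v).
Proof.
by rewrite /= demazure_half_root inv_part_half_root mul1r !ract0l ract1 add0r addr0.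
Qed.

(* F (x) id on the model extended by one strand to the right. *)
Definition peel (F : E -> E) v : E := glue (F (even_poly v)) (F (odd_poly v)).

Lemma peel_is_linear (F : {linear E -> E}) : linear (peel F).
Proof. by move=> a u v; rewrite /peel !linearP glueZ glueD. Qed.

HB.instance Definition _ (F : {linear E -> E}) :=
  GRing.isLinear.Build K E E *:%R (peel F) (peel_is_linear F).

Lemma iter_peel_is_linear n (F : {linear E -> E}) : linear (iter n peel F).
Proof.
elim: n => [|n ih] /= a u v; first by rewrite linearP.
by rewrite /peel !linearP !ih glueZ glueD.
Qed.

HB.instance Definition _ n (F : {linear E -> E}) :=
  GRing.isLinear.Build K E E *:%R (iter n peel F) (iter_peel_is_linear n F).

Lemma iter_peel_comp n (F G : E -> E) : iter n peel (F \o G) = iter n peel F \o iter n peel G.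
Proof.
elim: n => [//|n ih]; rewrite !iterS ih; apply/funext => v.
by rewrite /peel /= !glueE.
Qed.

Lemma iter_peel_id n : iter n peel id = id.
Proof. by elim: n => [//|n ih]; apply/funext => v; rewrite iterS ih /peel /= glue_even_odd. Qed.

Lemma iter_peel_sum n (I : Type) (s : seq I) (a : I -> K) (F : I -> E -> E) :
  iter n peel (fun v => \sum_(i <- s) a i *: F i v) =
  (fun v => \sum_(i <- s) a i *: iter n peel (F i) v).
Proof.
elim: n => [//|n ih]; apply/funext => v; rewrite iterS ih /peel.
elim: {ih}s => [|i s ihs]; first by rewrite !big_nil glue00.
by rewrite !big_cons -glueD -glueZ ihs.
Qed.

(** These are the bimodule maps of Soergel calculus, with N the model of [L]: [EndDot] multiplies n
    (x) f to n f, [StartDot] sends n to n d_c (x) 1 + n (x) d_c, [Split] inserts a middle factor 1,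
    and [Merge] applies the Demazure operator to the middle factor. [Cap] and [Cup] are the
    composites of these with a dot. *)
Definition event_op L (x : event K) v : E :=
  match x with
  | EndDot c => even_poly v + ract L (half_root K c) (odd_poly v)
  | StartDot c => glue (ract L (half_root K c) v) v
  | Merge _ => glue (odd_poly (even_poly v)) (odd_poly (odd_poly v))
  | Defs.Split _ => glue (glue (even_poly v) 0) (glue (odd_poly v) 0)
  | Cap c => odd_poly (even_poly v) + ract L (half_root K c) (odd_poly (odd_poly v))
  | Cup c => glue (glue (ract L (half_root K c) v) 0) (glue v 0)
  | Box f => ract L f v
  end.

Lemma glue0P a p q : glue (a *: p + q) 0 = a *: glue p 0 + glue q 0 :> E.
Proof. by rewrite glueZ glueD scaler0 addr0. Qed.

Lemma event_op_is_linear L x : linear (event_op L x).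
Proof.
case: x => [c|c|c|c|c|c|f] a u v /=.
- by rewrite !linearP /= scalerDr addrACA.
- by rewrite glueZ glueD linearP.
- by rewrite glueZ glueD !linearP.
- by rewrite glueZ glueD !linearP !glue0P.
- by rewrite !linearP /= scalerDr addrACA.
- by rewrite glueZ glueD linearP !glue0P.
- exact: linearP.
Qed.

HB.instance Definition _ L x :=
  GRing.isLinear.Build K E E *:%R (event_op L x) (event_op_is_linear L x).

(** Commutation with the right R-action is what lets an operator be tensored with further strands on
    its right. *)
Definition intertwines L1 L2 (F : E -> E) :=
  forall f v, F (ract L1 f v) = ract L2 f (F v).

Lemma peel_intertwines c L1 L2 (F : {linear E -> E}) :
  intertwines L1 L2 F -> intertwines (c :: L1) (c :: L2) (peel F).
Proof. by move=> hF f v; rewrite /peel /= !glueE !linearD /= !hF. Qed.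

Lemma iter_peel_intertwines L L1 L2 (F : {linear E -> E}) :
  intertwines L1 L2 F -> intertwines (L ++ L1) (L ++ L2) (iter (size L) peel F).
Proof. by move=> hF; elim: L => [//|c L ih] /=; apply: peel_intertwines. Qed.

Lemma ract_cons c L f v : ract (c :: L) f v =
  glue (ract L (inv_part c f) (even_poly v)
        + ract L (demazure c f * half_root K c ^+ 2) (odd_poly v))
       (ract L (demazure c f) (even_poly v) + ract L (inv_part c f) (odd_poly v)).
Proof. by []. Qed.

(** A c-invariant polynomial passes through the tensor product over R^c and so acts on N alone. *)
Lemma ract_invariant c L f v :
  demazure c f = 0 -> ract (c :: L) f v = peel (ract L f) v.
Proof. by move=> hf /=; rewrite hf inv_part_id // mul0r !ract0l addr0 add0r. Qed.

Lemma event_op_cap c L : event_op L (Cap K c) = event_op L (EndDot K c) \o event_op L (Merge K c).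
Proof. by apply/funext => v /=; rewrite !glueE. Qed.

Lemma event_op_cup c L :
  event_op L (Cup K c) = event_op (c :: L) (Defs.Split K c) \o event_op L (StartDot K c).
Proof. by apply/funext => v /=; rewrite !glueE. Qed.

Lemma intertwines_comp L1 L2 L3 (F G : E -> E) :
  intertwines L2 L3 F -> intertwines L1 L2 G -> intertwines L1 L3 (F \o G).
Proof. by move=> hF hG f v /=; rewrite hG hF. Qed.

Lemma endDot_intertwines c L : intertwines (c :: L) L (event_op L (EndDot K c)).
Proof.
move=> f v /=; rewrite !glueE [X in _ = ract L X _](inv_part_decomp c f).
move: (inv_part c f) (demazure c f) (half_root K c) => a b h.
rewrite !ractDr -!ractM addrACA -!ractDl.
by congr (ract L _ _ + ract L _ _); ring.
Qed.

Lemma startDot_intertwines c L : intertwines L (c :: L) (event_op L (StartDot K c)).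
Proof.
move=> f v /=; rewrite !glueE -!ractM -!ractDl.
rewrite {1 2}(inv_part_decomp c f).
move: (inv_part c f) (demazure c f) (half_root K c) => a b h.
by congr (glue (ract L _ _) (ract L _ _)); ring.
Qed.

(** The coefficients through which f acts on the outer factor, including the one with
    [half_root ^+ 2], are c-invariant. They therefore pass through both tensor signs and act on N,
    while [Merge] only selects coordinates. *)
Lemma merge_intertwines c L : intertwines (c :: c :: L) (c :: L) (event_op L (Merge K c)).
Proof.
move=> f v; rewrite /event_op (ract_cons c (c :: L)) !glueE.
rewrite (ract_invariant L _ (demazure_inv_part c f)) (ract_invariant L _ (demazureK c f)).
rewrite !(ract_invariant L _ (demazure_half_root_sqr (demazureK c f))).
by rewrite (ract_invariant L _ (demazure_inv_part c f)) /peel !glueD !glueE ract_cons !glueE.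
Qed.

Lemma split_intertwines c L :
  intertwines (c :: L) (c :: c :: L) (event_op L (Defs.Split K c)).
Proof.
move=> f v; rewrite /event_op (ract_cons c L f v) (ract_cons c (c :: L)) !glueE.
rewrite (ract_invariant L _ (demazure_inv_part c f)) (ract_invariant L _ (demazureK c f)).
rewrite !(ract_invariant L _ (demazure_half_root_sqr (demazureK c f))).
rewrite (ract_invariant L _ (demazure_inv_part c f)) /peel !glueE.
by rewrite !linear0 !glueD !addr0.
Qed.

Lemma event_op_intertwines L x :
  intertwines (rev (dom x) ++ L) (rev (cod x) ++ L) (event_op L x).
Proof.
case: x => [c|c|c|c|c|c|g].
- exact: endDot_intertwines.
- exact: startDot_intertwines.
- exact: merge_intertwines.
- exact: split_intertwines.
- by rewrite event_op_cap; apply/(intertwines_comp (endDot_intertwines c L))/merge_intertwines.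
- by rewrite event_op_cup; apply/(intertwines_comp (split_intertwines c L))/startDot_intertwines.
by move=> f v /=; rewrite ractC.
Qed.

(** The formulas of [event_op] use the model to the left only through its right R-action, and F
    commutes with that action. This is the reason why distant events commute. *)
Lemma event_op_natural L1 L2 x (F : {linear E -> E}) : intertwines L1 L2 F ->
  event_op L2 x \o iter (size (dom x)) peel F =
  iter (size (cod x)) peel F \o event_op L1 x.
Proof.
move=> hF; apply/funext => v; case: x => [c|c|c|c|c|c|g]; rewrite /= /peel ?glueE.
all: by rewrite ?linearD ?linear0 /= ?hF.
Qed.

#[local] Arguments ract : simpl never.

(** Strands to the left determine the module on which the event acts; each strand to the right is
    one more doubling, crossed by [peel]. Words are reversed because the rightmost strand is the
    outermost doubling. *)
Definition slice_op L (x : slice K) : E -> E :=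
  iter (size x.2) peel (event_op (rev x.1.1 ++ L) x.1.2).

HB.instance Definition _ L x := GRing.Linear.on (slice_op L x).

Definition diagram_op L (d : diagram K) v : E := foldl (fun u x => slice_op L x u) v d.

Lemma diagram_op_cons L x d : diagram_op L (x :: d) = diagram_op L d \o slice_op L x.
Proof. by []. Qed.

Lemma diagram_op_cat L d1 d2 : diagram_op L (d1 ++ d2) = diagram_op L d2 \o diagram_op L d1.
Proof. by apply/funext => v; rewrite /diagram_op foldl_cat. Qed.

Lemma diagram_op_is_linear L d : linear (diagram_op L d).
Proof. by elim: d => [//|x d ih] a u v; rewrite diagram_op_cons /= linearP ih. Qed.

HB.instance Definition _ L d :=
  GRing.isLinear.Build K E E *:%R (diagram_op L d) (diagram_op_is_linear L d).

(** Locality of the action: left strands are absorbed into the base word and right strands into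
    [peel], so a local relation only has to be checked unwhiskered, over an arbitrary [L]. *)
Lemma diagram_op_whisker L l d r :
  diagram_op L (whisker l d r) = iter (size r) peel (diagram_op (rev l ++ L) d).
Proof.
elim: d => [|x d ih]; first by rewrite iter_peel_id.
rewrite diagram_op_cons iter_peel_comp -ih /= diagram_op_cons; congr (_ \o _).
by rewrite /slice_op /= size_cat addnC iterD rev_cat catA.
Qed.

Lemma isotopy_sound L d d' : isotopy d d' -> diagram_op L d = diagram_op L d'.
Proof.
case=> {d d'} [g h m|c|c|c|c|c|c]; rewrite !diagram_op_cons.
  rewrite /slice_op /= !size_cat !rev_cat -!catA ![(size m + _)%N]addnC !iterD.
  (* Naturality of [h] with respect to [g] extended by the strands [m] between them. *)
  congr (id \o _); apply: event_op_natural.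
  by rewrite -(size_rev m); apply/iter_peel_intertwines/event_op_intertwines.
all: apply/funext => v; rewrite /slice_op /= /peel /= ?ract_half_root !glueE ?linear0 ?addr0 //.
- by rewrite glueD add0r addr0 glue_even_odd.
- by rewrite glue_even_odd.
Qed.

Lemma local_rel_sound L d ds : local_rel d ds ->
  diagram_op L d = (fun v => \sum_(p <- ds) p.1 *: diagram_op L p.2 v).
Proof.
case=> {d ds} [d d' /isotopy_sound-> |a f g|f g||c|c|c|c|c f|c]; apply/funext => v.
all: rewrite !(big_cons, big_nil) ?scale1r ?addr0 //=.
all: rewrite /diagram_op /slice_op /= /peel /=.
- by rewrite ractDl ractZl.
- by rewrite -ractM mulrC.
- by rewrite ract1.
- by rewrite !glueE.
- by rewrite !glueE !linear0 !addr0 glue_even_odd.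
- by rewrite !glueE ract_half_root !glueE linear0 glueD add0r addr0 glue_even_odd.
- by rewrite !glueE -ractDl half_rootD.
(* Slide relation: for f = a + h b with a and b invariant, on n (x) 1 it reads f (x) 1 = 1 (x) (a -
   h b) + b (h (x) 1 + 1 (x) h). The component n (x) h is checked likewise. *)
- rewrite ract_cons inv_part_act demazure_act glueD.
  have e := inv_part_decomp c f; rewrite [in LHS]e.
  move: (inv_part c f) (demazure c f) (half_root K c) {e} => a b h.
  rewrite !ractDr -!ractM addrACA -!ractDl; congr glue.
    transitivity (ract L (a + h * b) (even_poly v) + ract L 0 (odd_poly v)).
      by rewrite ract0l addr0.
    by congr (ract L _ _ + ract L _ _); ring.
  transitivity (ract L 0 (even_poly v) + ract L (a + h * b) (odd_poly v)).
    by rewrite ract0l add0r.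
  by rewrite addrACA -!ractDl; congr (ract L _ _ + ract L _ _); ring.
by rewrite !glueE !linear0 addr0.
Qed.

End Representation.

(** * Linear independence *)

Section LinearExtension.
Variables (K : fieldType) (M : choiceType) (V : lmodType K) (h : M -> V).

Definition lin_ext (x : {malg K[M]}) : V := \sum_(k <- monalg.msupp x) monalg.mcoeff k x *: h k.

Lemma lin_ext_is_linear : linear lin_ext.
Proof.
(* One finite set containing all three supports, since cancellation may shrink the support of the
   sum. *)
move=> a x y; pose D := (monalg.msupp (a *: x + y) `|` (monalg.msupp x `|` monalg.msupp y))%fset.
have lin_extEw z : (monalg.msupp z `<=` D)%fset ->
    lin_ext z = \sum_(k <- D) monalg.mcoeff k z *: h k.
  move=> le; rewrite [LHS](big_fset_incl _ le) => //= k _ /monalg.mcoeff_outdom ->.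
  by rewrite scale0r.
rewrite !lin_extEw ?scaler_sumr -?big_split /=.
- by apply: eq_bigr => k _; rewrite monalg.mcoeffD monalg.mcoeffZ scalerDl scalerA.
- by rewrite /D fsetUA fsubsetUr.
- by rewrite /D fsetUCA fsubsetUl.
exact: fsubsetUl.
Qed.

HB.instance Definition _ :=
  GRing.isLinear.Build K {malg K[M]} V *:%R lin_ext lin_ext_is_linear.

Lemma lin_extU k : lin_ext << k >> = h k.
Proof. by rewrite /lin_ext monalg.msuppU oner_eq0 big_seq_fset1 monalg.mcoeffUU scale1r. Qed.

End LinearExtension.

Lemma malgUUM (K : fieldType) (M : monomType) (c1 c2 : K) (k1 k2 : M) :
  << c1 *g k1 >> * << c2 *g k2 >> = << c1 * c2 *g mmul k1 k2 >> :> {malg K[M]}.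
Proof. by rewrite malgM_def fgmulUU. Qed.

Lemma malgUM (K : fieldType) (M : monomType) (k1 k2 : M) :
  << k1 >> * << k2 >> = << mmul k1 k2 >> :> {malg K[M]}.
Proof. by rewrite malgUUM mulr1. Qed.

Lemma malgUZ (K : fieldType) (M : choiceType) (a : K) (k : M) :
  << a *g k >> = a *: << k >> :> {malg K[M]}.
Proof.
by apply/malgP => j; rewrite monalg.mcoeffZ !monalg.mcoeffU; case: eqP; rewrite ?mulr1 ?mulr0.
Qed.

Lemma malg_ind (K : fieldType) (M : choiceType) (P : {malg K[M]} -> Prop) :
  P 0 -> (forall a k x, P x -> P (a *: << k >> + x)) -> forall x, P x.
Proof.
move=> P0 PD x; rewrite (monalgE x).
elim: (monalg.msupp x : seq M) => [|k s ih]; first by rewrite big_nil.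
rewrite big_cons malgUZ; exact: PD.
Qed.

Lemma malg_scalerAr (K : fieldType) (M : monomType) (a : K) (x y : {malg K[M]}) :
  x * (a *: y) = a *: (x * y).
Proof.
have monM k : << k >> * (a *: y) = a *: (<< k >> * y).
  elim/malg_ind: y => [|c j y ih]; first by rewrite scaler0 mulr0 scaler0.
  rewrite scalerDr !mulrDr ih scalerDr scalerA -!malgUZ; congr (_ + _).
  by rewrite !malgUUM (mul1r (a * c)) (mul1r c) (malgUZ (a * c)) (malgUZ c) scalerA.
elim/malg_ind: x => [|b k x ih]; first by rewrite !mul0r scaler0.
by rewrite !mulrDl -!scalerAl monM ih scalerDr !scalerA mulrC.
Qed.

(** * The action of linear combinations of graphs, and its vanishing on the ideal of relations *)

Section Action.
Variables (K : numFieldType) (u : seq color).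
Local Notation E := {poly K}.
Implicit Types (x y : {malg K[graph K u]}) (v : E).

Definition graph_op v x : E := lin_ext (fun g : graph K u => diagram_op [::] g v) x.

Lemma graph_op_is_linear v : linear (graph_op v).
Proof. exact: lin_ext_is_linear. Qed.

HB.instance Definition _ v :=
  GRing.isLinear.Build K {malg K[graph K u]} E *:%R (graph_op v) (graph_op_is_linear v).

Lemma graph_opU v g : graph_op v << g >> = diagram_op [::] g v.
Proof. exact: lin_extU. Qed.

Lemma graph_opPl x a v v' : graph_op (a *: v + v') x = a *: graph_op v x + graph_op v' x.
Proof.
elim/malg_ind: x => [|b k x ih]; first by rewrite !linear0 addr0.
rewrite !linearP /= ih !graph_opU linearP /= !scalerDr !scalerA [b * a]mulrC.
by rewrite addrACA.
Qed.

Lemma graph_op0l x : graph_op 0 x = 0.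
Proof. by have := graph_opPl x (-1) 0 0; rewrite !scaleN1r oppr0 addr0 addNr. Qed.

(** In a product the second factor is stacked on top, so [x] acts first: the model is a right
    module. *)
Lemma graph_opM v x y : graph_op v (x * y) = graph_op (graph_op v x) y.
Proof.
elim/malg_ind: x => [|a k x ih]; first by rewrite mul0r !linear0 graph_op0l.
rewrite mulrDl -scalerAl !linearP /= graph_opPl ih; congr (_ *: _ + _).
elim/malg_ind: y {ih} => [|b j y ih]; first by rewrite mulr0 !linear0.
rewrite mulrDr malg_scalerAr !linearP /= ih; congr (_ *: _ + _).
by rewrite malgUM !graph_opU diagram_op_cat.
Qed.

Lemma graph_rel_sound x y : graph_rel x y -> forall v, graph_op v x = graph_op v y.
Proof.
case=> {x y} [pre post l r d ds e es hd he hes|pre post r k f e k0 hf he] v.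
  rewrite linear_sum graph_opU he !diagram_op_cat diagram_op_whisker cats0 (local_rel_sound _ hd).
  rewrite iter_peel_sum /= linear_sum /=.
  have -> : \sum_(p <- es) graph_op v (p.1 *: << p.2 >>) =
      \sum_(q <- [seq (p.1, graph_val p.2) | p <- es]) q.1 *: diagram_op [::] q.2 v.
    by rewrite big_map; apply: eq_bigr => p _; rewrite linearZ /= graph_opU.
  rewrite hes big_map; apply: eq_bigr => p _.
  by rewrite linearZ /= !diagram_op_cat diagram_op_whisker cats0.
rewrite linear0 graph_opU he diagram_op_cat diagram_op_cons /=.
(* In the leftmost region the model is C = R / R_+, where f acts by its constant coefficient; this
   is 0 in positive degree. *)
have -> : slice_op [::] ([::], Box f, r) = iter (size r) (@peel K) (fun=> 0).
  congr (iter _ (@peel K) _); apply/funext => w /=.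
  rewrite (dhomog_nemf_coeff hf) ?scale0r //.
  by rewrite -[mpoly.Measure.sort _ _]/(mdeg 0%MM) mdeg0 eq_sym -lt0n.
have -> : iter (size r) (@peel K) (fun=> 0 : E) = fun=> 0.
  by elim: (size r) => [//|n ih]; rewrite iterS ih; apply/funext => w; rewrite /peel glue00.
exact: linear0.
Qed.

Lemma graph_op_ideal x : rel_ideal (@graph_rel K u) x -> forall v, graph_op v x = 0.
Proof.
elim=> {x} [x y /graph_rel_sound h v||x y _ hx _ hy v|a x _ hx v|x a _ hx v].
- by rewrite linearB /= h subrr.
- by move=> v; rewrite linear0.
- by rewrite linearD /= hx hy addr0.
- by rewrite graph_opM hx.
by rewrite graph_opM hx graph_op0l.
Qed.

End Action.

(** * Independence of the images of 1 under products of distinct broken lines *)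

Section Independence.
Variable K : numFieldType.
Local Notation E := {poly K}.

(** The start vector 1 encodes 1 (x) ... (x) 1 for every word. Indexing [b] by [nat] lets the same
    [b] serve for all prefixes of [u]. *)
Definition broken_vec (u : seq color) (b : nat -> bool) : E :=
  foldl (fun v i => if b i then diagram_op [::] (broken K u i) v else v) 1
    (iota 0 (size u)).

Lemma broken_rcons u c i : (i < size u)%N ->
  broken K (rcons u c) i = whisker [::] (broken K u i) [:: c].
Proof.
move=> hi; rewrite /broken /whisker /= nth_rcons hi -cats1 take_cat hi drop_cat.
have [hi'|] := ltnP i.+1 (size u); first by [].
rewrite leq_eqVlt ltnS leqNgt hi orbF => /eqP e.
by rewrite -e subnn drop_size.
Qed.

(** Breaking earlier strands acts inside the even component, and breaking the last strand sends x
    (x) 1 to x d_c (x) 1 + x (x) d_c. Thus the odd component is nonzero only if the last strand is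
    broken. *)
Lemma broken_vec_rcons u c b : broken_vec (rcons u c) b =
  let x := broken_vec u b in
  if b (size u) then glue (ract (rev u) (half_root K c) x) x else glue x 0.
Proof.
rewrite {1}/broken_vec size_rcons -addn1 iotaD foldl_cat add0n /=.
(* The start vector 1 has even component 1 and odd component 0. *)
rewrite -[X in foldl _ X (iota 0 _)](glue10 K).
have foldE : forall s (x : E), {subset s <= iota 0 (size u)} ->
  foldl (fun v i => if b i then diagram_op [::] (broken K (rcons u c) i) v else v) (glue x 0) s
  = glue (foldl (fun v i => if b i then diagram_op [::] (broken K u i) v else v) x s) 0.
  elim=> [//|i s ih] x hs /=; rewrite -ih; last by move=> j hj; apply: hs; rewrite inE hj orbT.
  congr foldl; case: (b i) => //.
  have hi : (i < size u)%N by have := hs i (mem_head _ _); rewrite mem_iota.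
  rewrite -[LHS]/(diagram_op [::] (broken K (rcons u c) i) (glue x 0)) broken_rcons //.
  by rewrite diagram_op_whisker /= /peel !glueE linear0.
rewrite foldE // -/(broken_vec u b); case: (b _) => //.
rewrite nth_rcons ltnn eqxx -cats1 take_size_cat // drop_oversize ?size_cat ?addn1 //.
by rewrite /slice_op /= !glueE linear0 addr0 cats0.
Qed.

(** Induction on the word, splitting the indices by the bit of the last strand. The predicate [P]
    makes room for this split, and the hypothesis on [b] says that the positions of [u] separate the
    indices. *)
Lemma broken_vec_independent (u : seq color) (I : finType) (b : I -> nat -> bool)
    (P : pred I) (a : I -> K) :
  {in P &, forall i j, (forall k, (k < size u)%N -> b i k = b j k) -> i = j} ->
  \sum_(i | P i) a i *: broken_vec u (b i) = 0 -> {in P, forall i, a i = 0}.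
Proof.
elim/last_ind: u P => [|u c ih] P inj sum0 i Pi.
  (* For the empty word nothing separates indices, so [i] is the only one, and its vector is 1. *)
  move: sum0; rewrite (big_pred1 i) => [|j]; last first.
    apply/idP/eqP => [Pj|->//]; exact: inj.
  move/eqP; rewrite scaler_eq0 => /orP[/eqP//|/eqP e1]; have := oner_neq0 E.
  by rewrite -e1 eqxx.
have injS B : {in [pred i | P i & b i (size u) == B] &, forall i j,
    (forall k, (k < size u)%N -> b i k = b j k) -> i = j}.
  move=> j k /andP[Pj /eqP bj] /andP[Pk /eqP bk] e; apply: inj => // m.
  rewrite size_rcons ltnS leq_eqVlt => /orP[/eqP->|/e//]; by rewrite bj bk.
(* The odd component of the sum retains exactly the terms whose last strand is broken. *)
have zeroT : {in [pred i | P i & b i (size u) == true], forall i, a i = 0}.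
  apply: ih (injS true) _.
  have /= := congr1 (@odd_poly K) sum0; rewrite linear_sum linear0 => h; rewrite -[RHS]h.
  rewrite [LHS]big_mkcond [RHS]big_mkcond; apply: eq_bigr => j _ /=.
  case: (P j) => //; rewrite broken_vec_rcons; case: (b j (size u)); rewrite linearZ /= glueE //.
  by rewrite scaler0.
case bi: (b i (size u)); first by apply: zeroT; rewrite unfold_in /= bi andbT.
(* Those coefficients being zero, the even component is a relation among the remaining terms. *)
apply: (ih _ (injS false) _ i); last by rewrite unfold_in /= bi andbT.
have /= := congr1 (@even_poly K) sum0; rewrite linear_sum linear0 => h; rewrite -[RHS]h.
rewrite [LHS]big_mkcond [RHS]big_mkcond; apply: eq_bigr => j _ /=.
case Pj: (P j) => //; rewrite broken_vec_rcons.
case bj: (b j (size u)); rewrite linearZ /= glueE //.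
by rewrite zeroT ?scale0r // unfold_in /= Pj bj.
Qed.

End Independence.

Section PresentedTheory.
Variables (K : fieldType) (A : lalgType K) (rel : A -> A -> Prop).

Lemma pres_class_is_linear : linear (pres_class rel).
Proof. by move=> a x y; rewrite pres_classD -pres_classZ. Qed.

HB.instance Definition _ := GRing.isLinear.Build K A (presented rel) *:%R
  (pres_class rel) pres_class_is_linear.

Lemma pres_class_is_monoid_morphism : GRing.monoid_morphism (pres_class rel).
Proof. by split=> // x y; rewrite -pres_classM. Qed.

HB.instance Definition _ := GRing.isMonoidMorphism.Build A (presented rel)
  (pres_class rel) pres_class_is_monoid_morphism.

Lemma pres_class_rel x y : rel x y -> pres_class rel x = pres_class rel y.
Proof. by move=> xy; apply/pres_eqP/ideal_rel. Qed.

Lemma pres_class_mul (x y : A) : pres_class rel (x * y) = pres_class rel x * pres_class rel y.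
Proof. exact: rmorphM. Qed.

Lemma pres_class_scale a (x : A) : pres_class rel (a *: x) = a *: pres_class rel x.
Proof. exact: linearZ. Qed.

Lemma pres_scalerAl (a : K) (x y : presented rel) : a *: (x * y) = (a *: x) * y.
Proof.
elim/pres_ind: x => x; elim/pres_ind: y => y.
by rewrite -pres_class_mul -!pres_class_scale -pres_class_mul scalerAl.
Qed.

Lemma pres_scalerAr (assoc : forall (a : K) (x y : A), x * (a *: y) = a *: (x * y))
  (a : K) (x y : presented rel) : x * (a *: y) = a *: (x * y).
Proof.
elim/pres_ind: x => x; elim/pres_ind: y => y.
by rewrite -pres_class_mul -!pres_class_scale -pres_class_mul assoc.
Qed.

End PresentedTheory.

Section AwAction.
Variables (K : numFieldType) (u : seq color).
Local Notation E := {poly K}.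
Local Notation A := (presented (@graph_rel K u)).
Implicit Types (x y : A) (v : E).

Definition pres_op v x : E := graph_op v (repr x).

Lemma pres_op_class v (x : {malg K[graph K u]}) :
  pres_op v (pres_class (@graph_rel K u) x) = graph_op v x.
Proof.
apply/eqP; rewrite -subr_eq0 -[_ - _](linearB (graph_op v)); apply/eqP.
exact/graph_op_ideal/pres_repr.
Qed.

Lemma pres_op_is_linear v : linear (pres_op v).
Proof.
move=> a x y; elim/pres_ind: x => x; elim/pres_ind: y => y.
by rewrite -linearP /= !pres_op_class linearP.
Qed.

HB.instance Definition _ v := GRing.isLinear.Build K A E *:%R (pres_op v) (pres_op_is_linear v).

Lemma pres_op1 v : pres_op v 1 = v.
Proof. by rewrite -(rmorph1 (pres_class (@graph_rel K u))) pres_op_class graph_opU. Qed.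

Lemma pres_opM v x y : pres_op v (x * y) = pres_op (pres_op v x) y.
Proof.
elim/pres_ind: x => x; elim/pres_ind: y => y.
by rewrite -rmorphM /= !pres_op_class graph_opM.
Qed.

Lemma pres_op_prod (I : Type) (s : seq I) (F : I -> A) v :
  pres_op v (\prod_(i <- s) F i) = foldl (fun v i => pres_op v (F i)) v s.
Proof.
elim: s v => [|i s ih] v; first by rewrite big_nil pres_op1.
by rewrite big_cons pres_opM ih.
Qed.

End AwAction.

Section BnIndependent.
Variables (K : numFieldType) (w : W).

(** The exponent function is extended by [false] to indices beyond the length of [w]. *)
Lemma pres_op_Bn (f : {ffun 'I_(len w) -> bool}) :
  pres_op 1 (Bn K f) = broken_vec K (red_word w) (fun k => oapp f false (insub k)).
Proof.
have opX i v : pres_op v (Xgen K i ^+ f i) =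
    if f i then diagram_op [::] (broken K (red_word w) i) v else v.
  case: (f i); last by rewrite expr0 pres_op1.
  by rewrite expr1 [LHS]pres_op_class graph_opU.
rewrite /Bn /Xpow pres_op_prod /broken_vec size_tuple -val_enum_ord.
rewrite /index_enum locked_withE -enumT.
elim: (enum _) (1 : {poly K}) => [//|i s ih] v; rewrite [LHS]/= ih opX.
by rewrite [RHS]/= valK.
Qed.

Lemma Bn_lin_indep : lin_indep (@Bn K w).
Proof.
move=> a sum0 f; apply: (@broken_vec_independent K (red_word w)
  {ffun 'I_(len w) -> bool} (fun f k => oapp f false (insub k)) predT a) => //.
  move=> f1 f2 _ _ e; apply/ffunP => i.
  by have := e i; rewrite size_tuple ltn_ord valK => /(_ isT).
have /= := congr1 (pres_op (1 : {poly K})) sum0; rewrite linear_sum linear0 => h.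
by rewrite -[RHS]h; apply: eq_bigr => i _; rewrite linearZ /= pres_op_Bn.
Qed.

End BnIndependent.

(** * Relations between broken lines *)

Section DiagramCalculus.
Variables (K : numFieldType) (u : seq color).
Local Notation A := (presented (@graph_rel K u)).
Implicit Types (d pre post : diagram K) (l m r : seq color) (c : color).

(* 0 on diagrams that are not S-graphs from u to u. *)
Definition diagram_class d : A :=
  if insub d is Some g then pres_class (@graph_rel K u) << (g : graph K u) >> else 0.

Lemma diagram_classE (g : graph K u) :
  diagram_class g = pres_class (@graph_rel K u) << g >>.
Proof. by rewrite /diagram_class valK. Qed.

Lemma diagram_classM d1 d2 : is_graph u u d1 -> is_graph u u d2 ->
  diagram_class (d1 ++ d2) = diagram_class d1 * diagram_class d2.
Proof.
move=> g1 g2; rewrite -[d1]/(val (Graph g1)) -[d2]/(val (Graph g2)) !diagram_classE.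
rewrite -[RHS](rmorphM (pres_class (@graph_rel K u))) /= malgUM.
by rewrite -diagram_classE.
Qed.

Lemma is_graph_whisker a b d l r : is_graph a b d ->
  is_graph (l ++ a ++ r) (l ++ b ++ r) (whisker l d r).
Proof.
elim: d a => [|x d ih] a /=; first by move/eqP->.
case/and3P=> /eqP-> -> /ih hd.
move: hd; rewrite /bottom /top /= -!catA => ->.
by rewrite eqxx.
Qed.

Lemma diagram_class_local a b pre post l r d (ds : seq (K * diagram K)) :
  local_rel d ds -> is_graph a b d -> all (fun p => is_graph a b p.2) ds ->
  is_graph u (l ++ a ++ r) pre -> is_graph (l ++ b ++ r) u post ->
  diagram_class (pre ++ whisker l d r ++ post) =
  \sum_(p <- ds) p.1 *: diagram_class (pre ++ whisker l p.2 r ++ post).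
Proof.
move=> hd gd gds gpre gpost.
have graphE d' : is_graph a b d' -> is_graph u u (pre ++ whisker l d' r ++ post).
  by move=> gd'; apply/(is_graph_cat gpre)/(is_graph_cat _ gpost)/is_graph_whisker.
(* The default [graph_id] is never taken, as every term is an S-graph. *)
pose es := [seq (p.1, insubd (graph_id K u) (pre ++ whisker l p.2 r ++ post)) | p <- ds].
have e := diagram_classE (Graph (graphE _ gd)); rewrite [LHS]e.
rewrite (@pres_class_rel _ _ _ _ (\sum_(p <- es) p.1 *: << p.2 >>)); last first.
  apply: (@graph_local K u pre post l r d ds _ es) => //.
  rewrite -map_comp; apply/eq_in_map => p pds /=; congr pair.
  have := insubdK (graph_id K u); apply.
  exact/graphE/(allP gds).
rewrite linear_sum big_map big_seq [RHS]big_seq; apply: eq_bigr => p pds.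
rewrite linearZ /= -diagram_classE insubdK //.
exact/graphE/(allP gds).
Qed.

Lemma diagram_class_left pre post r k f : (0 < k)%N -> f \is k.-homog ->
  is_graph u u (pre ++ ([::], Box f, r) :: post) ->
  diagram_class (pre ++ ([::], Box f, r) :: post) = 0.
Proof.
move=> k0 hf g; rewrite -[pre ++ _]/(val (Graph g)) diagram_classE.
rewrite (@pres_class_rel _ _ _ _ 0) ?linear0 //.
exact: (graph_left k0 hf).
Qed.

Definition whisker_slice l (x : slice K) r : slice K := (l ++ x.1.1, x.1.2, x.2 ++ r).

Lemma exchange_slices (x y : slice K) l m r pre post :
  label_homog x.1.2 -> label_homog y.1.2 ->
  is_graph u (l ++ bottom x ++ m ++ bottom y ++ r) pre ->
  is_graph (l ++ top x ++ m ++ top y ++ r) u post ->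
  diagram_class (pre ++ [:: whisker_slice l x (m ++ bottom y ++ r),
                            whisker_slice (l ++ top x ++ m) y r & post]) =
  diagram_class (pre ++ [:: whisker_slice (l ++ bottom x ++ m) y r,
                            whisker_slice l x (m ++ top y ++ r) & post]).
Proof.
case: x => [[l1 g] r1]; case: y => [[l2 h] r2]; rewrite /bottom /top /whisker_slice /=.
move=> hg hh gpre gpost; pose m' := r1 ++ m ++ l2.
have := @diagram_class_local (dom g ++ m' ++ dom h) (cod g ++ m' ++ cod h)
  pre post (l ++ l1) (r2 ++ r) _ _ (rel_isotopy (iso_interchange g h m')).
rewrite /= big_seq1 /= scale1r /m' /bottom /top /= ?cats0 -!catA /= ?cats0.
move: gpre gpost; rewrite -!catA => gpre gpost.
by rewrite !eqxx hg hh; apply.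
Qed.

Lemma is_graph_whisker_slice l (x : slice K) r : label_homog x.1.2 ->
  is_graph (l ++ bottom x ++ r) (l ++ top x ++ r) [:: whisker_slice l x r].
Proof. by move=> hx; apply: (@is_graph_whisker _ _ [:: x]); rewrite /= hx !eqxx. Qed.

Lemma exchange_slice (x : slice K) a' b' d' l m r pre post :
  label_homog x.1.2 -> is_graph a' b' d' ->
  is_graph u (l ++ bottom x ++ m ++ a' ++ r) pre ->
  is_graph (l ++ top x ++ m ++ b' ++ r) u post ->
  diagram_class (pre ++ whisker_slice l x (m ++ a' ++ r)
                     :: whisker (l ++ top x ++ m) d' r ++ post) =
  diagram_class (pre ++ whisker (l ++ bottom x ++ m) d' r
                     ++ whisker_slice l x (m ++ b' ++ r) :: post).
Proof.
move=> hx; elim: d' a' pre => [|y d' ih] a' pre /=; first by move/eqP->.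
case/and3P=> /eqP-> hy gd' gpre gpost.
rewrite exchange_slices //; last first.
  have := is_graph_whisker (l ++ top x ++ m) r gd'.
  by move: gpost; rewrite -!catA => gpost' h; apply: is_graph_cat h gpost'.
rewrite -[_ :: whisker _ _ _ ++ _]cat1s -cat_rcons (ih (top y)) ?cat_rcons //.
rewrite -cats1; apply: (is_graph_cat gpre).
have := is_graph_whisker_slice (l ++ bottom x ++ m) r hy.
by rewrite -!catA.
Qed.

(** Double induction from the exchange of two slices: [exchange_slice] moves one slice past a whole
    diagram, and here the slices of [d] are moved one at a time. *)
Lemma exchange a b a' b' (d d' : diagram K) l m r pre post :
  is_graph a b d -> is_graph a' b' d' ->
  is_graph u (l ++ a ++ m ++ a' ++ r) pre -> is_graph (l ++ b ++ m ++ b' ++ r) u post ->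
  diagram_class (pre ++ whisker l d (m ++ a' ++ r) ++ whisker (l ++ b ++ m) d' r ++ post) =
  diagram_class (pre ++ whisker (l ++ a ++ m) d' r ++ whisker l d (m ++ b' ++ r) ++ post).
Proof.
elim: d a pre => [|x d ih] a pre /=.
  by move=> /eqP->.
case/and3P=> /eqP-> hx gd gd' gpre gpost.
rewrite -[_ :: _ ++ _]/(whisker_slice l x (m ++ a' ++ r) :: _ ++ _) -cat_rcons (ih (top x)) //.
  rewrite cat_rcons (exchange_slice hx gd' gpre) //.
  exact/(is_graph_cat _ gpost)/is_graph_whisker.
by rewrite -cats1; apply/(is_graph_cat gpre)/is_graph_whisker_slice.
Qed.

Lemma broken_middle l c r : broken K (l ++ c :: r) (size l) = whisker l (broken K [:: c] 0) r.
Proof.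
rewrite /broken /whisker /= take_size_cat // nth_cat ltnn subnn /= cats0.
by rewrite drop_cat ltnNge leqnSn /= subSnn /= drop0.
Qed.

Lemma broken_left l r i : (i < size l)%N -> broken K (l ++ r) i = whisker [::] (broken K l i) r.
Proof.
move=> hi; rewrite /broken /whisker /= nth_cat hi take_cat hi drop_cat.
case: ltnP => //; rewrite leq_eqVlt ltnS leqNgt hi orbF => /eqP e.
by rewrite -e subnn drop0 drop_size.
Qed.

(** The label 2 is the Demazure derivative of a root, left between the two dots by the slide
    relation. The proof uses linearity of boxes with 2 = [1 *: 1 + 1]. *)
Lemma box2 l r pre post : is_graph u (l ++ r) pre -> is_graph (l ++ r) u post ->
  diagram_class (pre ++ (l, Box 2, r) :: post) = 2 *: diagram_class (pre ++ post).
Proof.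
move=> gpre gpost.
have one_homog : (1 : {mpoly K[2]}) \is homog mdeg by exact/homogE/dhomog1.
have two_homog : (2 : {mpoly K[2]}) \is homog mdeg.
  by apply/(@homogE _ _ _ 0)/rpredMn/dhomog1.
have box1 : diagram_class (pre ++ (l, Box 1, r) :: post) = diagram_class (pre ++ post).
  have := @diagram_class_local [::] [::] pre post l r _ _ (rel_box_one K).
  by rewrite /= big_seq1 /= scale1r cats0 !andbT one_homog; apply.
have := @diagram_class_local [::] [::] pre post l r _ _ (rel_box_linear 1 1 1).
rewrite /= !big_cons big_nil /= !scale1r cats0 addr0 !andbT one_homog two_homog box1.
by rewrite scaler_nat; apply.
Qed.

Lemma whisker_whisker l1 l2 d r1 r2 :
  whisker l1 (whisker l2 d r1) r2 = whisker (l1 ++ l2) d (r1 ++ r2).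
Proof. by rewrite /whisker -map_comp; apply: eq_map => x /=; rewrite !catA. Qed.

Definition alternating l := sorted (fun c1 c2 : color => c1 != c2) l.

Lemma alternating_rcons2 l (c1 c2 : color) :
  alternating (rcons (rcons l c1) c2) = alternating (rcons l c1) && (c1 != c2).
Proof.
rewrite /alternating -!cats1 -catA; case: l => [|e l] /=; first by rewrite andbT.
by rewrite !cat_path /= !andbT andbA.
Qed.

(** Here [c] is the colour that would follow [l]. Moving the box left through the last strand [e] of
    [l] yields the root of [e] on its other side minus twice the broken strand, and the induction
    continues with [e] in the role of [c]. *)
Lemma box_root l c r pre post : alternating (rcons l c) ->
  is_graph u (l ++ r) pre -> is_graph (l ++ r) u post ->
  diagram_class (pre ++ (l, Box (simple_root K c), r) :: post) =
  \sum_(j < size l) (- 2) *: diagram_class (pre ++ whisker [::] (broken K l j) r ++ post).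
Proof.
have root_homog e : simple_root K e \is homog mdeg by exact/homogE/simple_root_homog.
have two_homog : (2 : {mpoly K[2]}) \is homog mdeg.
  by apply/(@homogE _ _ _ 0)/rpredMn/dhomog1.
elim/last_ind: l c r => [|l e ih] c r.
  (* No strand remains on the left: the root is homogeneous of degree 1 for [mdeg] and lies in the
     leftmost region. *)
  rewrite big_ord0 => _ gpre gpost; apply: (diagram_class_left (k := 1)) => //.
    exact: simple_root_homog.
  by apply: (is_graph_cat gpre); rewrite /= /bottom /= eqxx root_homog.
rewrite alternating_rcons2 => /andP[alt ec].
rewrite -cats1 -catA => gpre gpost.
(* The slide is applied to the root of [e] on the left of the strand: its reflection, minus itself,
   is the root of [c] on the right, because [c] and [e] differ. *)
have := @diagram_class_local [:: e] [:: e] pre post l r _ _ (rel_slide e (simple_root K e)).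
rewrite /= !big_cons big_nil /= !scale1r addr0 cats0 demazure_simple_root act_simple_root.
rewrite -(simple_root_neq K (_ : c != e)); last by rewrite eq_sym.
rewrite /bottom /top /= !eqxx !root_homog two_homog => /(_ isT isT gpre gpost).
rewrite (ih e (e :: r)) // => h; rewrite size_cat addn1 big_ord_recr.
have box2E :
  diagram_class (pre ++ [:: (l, EndDot K e, r), (l, Box 2, r), (l, StartDot K e, r) & post])
  = 2 *: diagram_class (pre ++ whisker [::] (broken K (l ++ [:: e]) (size l)) r ++ post).
  rewrite -[_ ++ [:: _, _ & _]]cat_rcons (@box2 l r).
  - by rewrite cat_rcons broken_middle /whisker /= cats0.
  - by rewrite -cats1; apply: (is_graph_cat gpre); rewrite /= /bottom /= !eqxx.
  by rewrite /= /bottom /= !eqxx.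
rewrite scaleNr; apply: (canRL (addrK _)); rewrite -box2E -h.
apply: eq_bigr => j _.
have -> // : whisker [::] (broken K l j) (e :: r) = whisker [::] (broken K (l ++ [:: e]) j) r.
by rewrite broken_left // whisker_whisker.
Qed.

(** The two broken strands are local pieces side by side, so one can be moved above the other. *)
Lemma broken_commute_lt i j : (i < j)%N -> (j < size u)%N ->
  diagram_class (broken K u i) * diagram_class (broken K u j) =
  diagram_class (broken K u j) * diagram_class (broken K u i).
Proof.
move=> lt_ij hj; have hi := ltn_trans lt_ij hj.
have gi := is_graph_broken K hi; have gj := is_graph_broken K hj.
have [l [c [m [e [r [eu sl sm]]]]]] : exists l c m e r,
    [/\ u = l ++ [:: c] ++ m ++ [:: e] ++ r, size l = i & size (l ++ [:: c] ++ m) = j].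
  exists (take i u), (nth cs u i), (take (j - i.+1) (drop i.+1 u)), (nth cs u j), (drop j.+1 u).
  have hij : (i.+1 + (j - i.+1) = j)%N by rewrite subnKC.
  have szi : size (take i u) = i by apply/size_takel/ltnW.
  have szm : size (take (j - i.+1) (drop i.+1 u)) = (j - i.+1)%N.
    by rewrite size_takel // size_drop leq_sub2r // ltnW.
  split; [|exact: szi|by rewrite !size_cat szi szm /= add1n addnS -addSn].
  rewrite -{1}(cat_take_drop i u) (drop_nth cs hi) /=; congr (_ ++ _ :: _).
  rewrite -{1}(cat_take_drop (j - i.+1) (drop i.+1 u)) drop_drop addnC hij.
  by rewrite (drop_nth cs hj).
have ei : broken K u i = whisker l (broken K [:: c] 0) (m ++ [:: e] ++ r).
  by rewrite eu -sl broken_middle.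
have ej : broken K u j = whisker (l ++ [:: c] ++ m) (broken K [:: e] 0) r.
  by rewrite -sm -broken_middle {1}eu -!catA.
have gb x : is_graph [:: x] [:: x] (broken K [:: x] 0) by rewrite /= /bottom /= !eqxx.
have gu : is_graph u (l ++ [:: c] ++ m ++ [:: e] ++ r) ([::] : diagram K) by rewrite -eu /= eqxx.
have gu' : is_graph (l ++ [:: c] ++ m ++ [:: e] ++ r) u ([::] : diagram K) by rewrite -eu /= eqxx.
have := exchange (gb c) (gb e) gu gu'.
by rewrite !cats0 -!diagram_classM // ei ej.
Qed.

Lemma broken_commute i j : (i < size u)%N -> (j < size u)%N ->
  diagram_class (broken K u i) * diagram_class (broken K u j) =
  diagram_class (broken K u j) * diagram_class (broken K u i).
Proof.
move=> hi hj; case: (ltngtP i j) => [ij|ji|->//]; first exact: broken_commute_lt.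
exact/esym/broken_commute_lt.
Qed.

(** In the stacked square the two inner dots form a barbell. Its root is evaluated by [box_root],
    with the strand's outer dots as the surrounding diagram. *)
Lemma broken_square l c r : u = l ++ c :: r -> alternating (rcons l c) ->
  diagram_class (broken K u (size l)) ^+ 2 =
  - 2 *: (diagram_class (broken K u (size l)) * \sum_(j < size l) diagram_class (broken K u j)).
Proof.
move=> eu alt.
have gE : is_graph u (l ++ r) [:: (l, EndDot K c, r)] by rewrite eu /= /bottom /= !eqxx.
have gS : is_graph (l ++ r) u [:: (l, StartDot K c, r)] by rewrite eu /= /top /= !eqxx.
have gi : is_graph u u (broken K u (size l)).
  by apply: is_graph_broken; rewrite eu size_cat /= addnS ltnS leq_addr.
have bE : broken K u (size l) = [:: (l, EndDot K c, r); (l, StartDot K c, r)].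
  by rewrite eu broken_middle /whisker /= cats0.
have barbellE : diagram_class (broken K u (size l) ++ broken K u (size l)) =
    diagram_class [:: (l, EndDot K c, r), (l, Box (simple_root K c), r)
                    & [:: (l, StartDot K c, r)]].
  have := @diagram_class_local [::] [::] [:: (l, EndDot K c, r)] [:: (l, StartDot K c, r)]
    l r _ _ (rel_barbell K c).
  rewrite bE /= big_seq1 /= scale1r cats0 /top /bottom /= !eqxx !andbT.
  by apply; rewrite -?eu ?eqxx //; exact/homogE/simple_root_homog.
rewrite expr2 -diagram_classM // barbellE.
apply: (etrans (box_root alt gE gS)); rewrite mulr_sumr scaler_sumr.
apply: eq_bigr => j _; congr (_ *: _).
have hj : (j < size u)%N by rewrite eu size_cat (leq_trans (ltn_ord j)) ?leq_addr.
have hi : (size l < size u)%N by rewrite eu size_cat /= addnS ltnS leq_addr.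
rewrite (broken_commute hi hj) -diagram_classM //; last exact: is_graph_broken.
have gD : is_graph [:: c] [::] [:: ([::], EndDot K c, [::])] by rewrite /= /bottom /= eqxx.
have gl : is_graph u ([::] ++ l ++ [::] ++ [:: c] ++ r) ([::] : diagram K) by rewrite /= eu eqxx.
(* The broken strand [j] sits between the two dots of the strand of colour [c]; exchanging it with
   the end dot turns the diagram into a product. *)
have := exchange (l := [::]) (m := [::]) (is_graph_broken K (ltn_ord j)) gD gl gS.
have -> : broken K u j = whisker [::] (broken K l j) (c :: r) by rewrite eu broken_left.
by rewrite bE /= !cats0 => <-.
Qed.

End DiagramCalculus.

(** * Dot-line algebra *)

Section SpanTheory.
Variables (K : fieldType) (V : lmodType K) (I : finType) (v : I -> V).

Lemma in_span0 : in_span v 0.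
Proof. by exists (fun=> 0); rewrite big1 // => i _; rewrite scale0r. Qed.

Lemma in_spanD x y : in_span v x -> in_span v y -> in_span v (x + y).
Proof.
move=> [a ->] [b ->]; exists (fun i => a i + b i); rewrite -big_split.
by apply: eq_bigr => i _; rewrite scalerDl.
Qed.

Lemma in_spanZ k x : in_span v x -> in_span v (k *: x).
Proof.
move=> [a ->]; exists (fun i => k * a i); rewrite scaler_sumr.
by apply: eq_bigr => i _; rewrite scalerA.
Qed.

Lemma in_span_sum (J : Type) (s : seq J) (P : pred J) (F : J -> V) :
  (forall j, P j -> in_span v (F j)) -> in_span v (\sum_(j <- s | P j) F j).
Proof.
by move=> h; apply: (big_ind (in_span v)) => //; [exact: in_span0|exact: in_spanD].
Qed.

Lemma in_span_gen i : in_span v (v i).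
Proof.
exists (fun j => (j == i)%:R); rewrite (bigD1 i) //= eqxx scale1r big1 ?addr0 //.
by move=> j /negbTE ->; rewrite scale0r.
Qed.

Lemma has_dim_span : lin_indep v -> has_dim (in_span v) #|I|.
Proof.
have sumE (a : 'I_#|I| -> K) :
    \sum_i a i *: v (enum_val i) = \sum_x a (enum_rank x) *: v x.
  rewrite (reindex _ (onW_bij _ (enum_rank_bij I))) /=.
  by apply: eq_bigr => x _; rewrite enum_rankK.
move=> free; exists (fun i => v (enum_val i)); split=> [a|x].
  by rewrite sumE => /free h i; have := h (enum_val i); rewrite enum_valK.
split=> [[a ->]|[a ->]]; last by rewrite sumE; exists (fun x => a (enum_rank x)).
exists (fun i => a (enum_val i)); rewrite sumE.
by apply: eq_bigr => y _; rewrite enum_rankK.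
Qed.

End SpanTheory.

Lemma exists_repeated_letter u : ~~ alternating u -> exists l c r, u = l ++ [:: c; c] ++ r.
Proof.
elim: u => [//|c [//|e u] ih] /=; rewrite negb_and negbK => /orP[/eqP<-|/ih].
  by exists [::], c, u.
by case=> l [d [r ->]]; exists (c :: l), d, r.
Qed.

(** Cancelling a repeated letter would give a shorter expression of [w], against minimality. *)
Lemma red_word_alternating w : alternating (red_word w).
Proof.
apply/negPn/negP => /exists_repeated_letter [l [c [r e]]].
have : expressible w (size (l ++ r)).
  apply/existsP; exists (in_tuple (l ++ r)) => /=.
  rewrite -(eqP (xchooseP (len_expressible w))) -/(red_word w) e; apply/eqP/eqmodP/asboolP.
  exact/word_sym/word_cancel.
rewrite /len in e *.
have := size_tuple (red_word w); rewrite e /len; case: ex_minnP => n _ minn sz /minn.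
by rewrite -sz !size_cat /= !addnS ltnNge leqnSn.
Qed.

Section Monomials.
Variables (A : pzRingType) (n : nat) (x : 'I_n -> A).
Hypothesis x_comm : forall i j, x i * x j = x j * x i.

Definition monomial (a : 'I_n -> nat) : A := \prod_(i < n) x i ^+ a i.

(** Only the generators are assumed to commute, so x_i is carried past the factors one by one until
    it meets its own power. *)
Lemma mul_gen_monomial i a : x i * monomial a = monomial (fun j => a j + (j == i))%N.
Proof.
rewrite /monomial.
have : i \in index_enum 'I_n by rewrite mem_index_enum.
elim: (index_enum _) (index_enum_uniq 'I_n) => [//|j s ih] /= /andP[js us].
rewrite inE !big_cons mulrA; case: (eqVneq i j) => [ij _|ij /= i_s].
  rewrite -ij /= -exprS addn1; congr (_ * _); apply: eq_big_seq => k ks.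
  by case: eqP => [e|_]; [move: js; rewrite -ij -e ks | rewrite addn0].
rewrite addn0 -ih // !mulrA; congr (_ * _).
exact/commrX/x_comm.
Qed.

End Monomials.

(** * Square-free monomials span the Dot-Line algebra *)

Section DotLineAlgebra.
Variables (K : fieldType) (n : nat).
Local Notation D := (presented (@DL_rel K n)).
Local Notation cls := (pres_class (@DL_rel K n)).

Definition DLgen (i : 'I_n) : D := cls (dvar K i).

Lemma DLgen_comm i j : DLgen i * DLgen j = DLgen j * DLgen i.
Proof. by rewrite /DLgen -!pres_class_mul; apply/pres_class_rel/DL_comm. Qed.

(** For the first generator the sum is empty, so both kinds of square relation take this form. *)
Lemma DLgen_square i : DLgen i ^+ 2 = - 2 *: (DLgen i * \sum_(j < n | (j < i)%N) DLgen j).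
Proof.
rewrite /DLgen expr2 -linear_sum -!pres_class_mul -pres_class_scale -expr2.
have [i0|i0] := posnP i; last exact/pres_class_rel/DL_square.
rewrite big1 => [|j]; last by rewrite i0.
by rewrite mulr0 scaler0; apply/pres_class_rel/DL_square0.
Qed.

Definition DLmon (S : {ffun 'I_n -> bool}) : D := monomial DLgen (fun i => nat_of_bool (S i)).

(** If S already contains i, the square relation turns X_i X_S into -2 times the sum of the X_j X_S
    with j < i: same S, smaller index. Hence the strong induction on i. *)
Lemma DLgen_mul_mon i S : in_span DLmon (DLgen i * DLmon S).
Proof.
have [m] := ubnP (i : nat); elim: m => [//|m ih] in i S *; rewrite ltnS => lt_im.
have mulE (S' : {ffun 'I_n -> bool}) : ~~ S' i ->
    DLgen i * DLmon S' = DLmon [ffun j => S' j || (j == i)].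
  move=> S'i; rewrite mul_gen_monomial; last exact: DLgen_comm.
  apply: eq_bigr => j _; rewrite ffunE; congr (_ ^+ _).
  by case: eqVneq => [->|_]; rewrite ?(negbTE S'i) ?orbT ?orbF ?addn0.
case Si: (S i); last by rewrite mulE ?Si //; exact: in_span_gen.
have SE : DLmon S = DLgen i * DLmon [ffun j => S j && (j != i)].
  rewrite mulE ?ffunE ?eqxx ?andbF //; congr DLmon; apply/ffunP => j; rewrite !ffunE.
  by case: eqVneq => [->|_]; rewrite ?andbF ?andbT ?orbF ?orbT.
rewrite SE mulrA -expr2 DLgen_square -pres_scalerAl; apply: in_spanZ.
rewrite -mulrA mulr_suml mulr_sumr; apply: in_span_sum => j ji.
(* X_i X_j times the monomial without i equals X_j X_S. *)
rewrite mulrA DLgen_comm -mulrA -SE; apply: ih; exact: leq_trans lt_im.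
Qed.

(** Every word is built from the empty one, whose class is the empty monomial, by left
    multiplications by generators, and these preserve the span. *)
Lemma DLmon_span x : in_span DLmon x.
Proof.
have mulS i y : in_span DLmon y -> in_span DLmon (DLgen i * y).
  move=> [a ->]; rewrite mulr_sumr; apply: in_span_sum => S _.
  rewrite pres_scalerAr; last exact: malg_scalerAr.
  exact/in_spanZ/DLgen_mul_mon.
elim/pres_ind: x => x; elim/malg_ind: x => [|a k x ih].
  by rewrite linear0; apply: in_span0.
rewrite pres_classD pres_class_scale; apply/in_spanD/ih/in_spanZ.
case: k => s; elim: s => [|i s ihs].
  rewrite (_ : << _ >> = 1); last by congr << _ >>; apply/eqP; rewrite fmP fm1.
  rewrite (_ : cls 1 = DLmon [ffun=> false]); first exact: in_span_gen.
  by rewrite /DLmon /monomial big1 ?rmorph1 // => i _; rewrite ffunE.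
rewrite (_ : << _ >> = dvar K i * << FMonom s >>); last first.
  by rewrite malgUM; congr << _ >>; apply/eqP; rewrite fmP fmM fmU.
by rewrite pres_class_mul; apply: mulS.
Qed.

End DotLineAlgebra.

(** * The morphism from the Dot-Line algebra to [Aw], its kernel and its image *)

Section DotLineMorphism.
Variables (K : numFieldType) (w : W).
Local Notation D := (presented (@DL_rel K (len w))).
Local Notation A := (presented (@graph_rel K (red_word w))).

Definition broken_line (i : 'I_(len w)) : A := Xgen K i.

Lemma broken_lineE i : broken_line i = diagram_class (red_word w) (broken K (red_word w) i).
Proof. exact/esym/(diagram_classE (Graph (is_graph_Xgen K i))). Qed.

Lemma broken_line_comm i j : broken_line i * broken_line j = broken_line j * broken_line i.
Proof. by rewrite !broken_lineE broken_commute ?size_tuple. Qed.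

Lemma broken_line_square i : broken_line i ^+ 2 =
  - 2 *: (broken_line i * \sum_(j < len w | (j < i)%N) broken_line j).
Proof.
have hi : (i < size (red_word w))%N by rewrite size_tuple.
pose l := take i (red_word w); pose c := nth cs (red_word w) i.
have eu : red_word w = l ++ c :: drop i.+1 (red_word w) :> seq color.
  by rewrite -drop_nth ?cat_take_drop.
have sl : size l = i by rewrite size_take hi.
have alt : alternating (rcons l c).
  by rewrite -take_nth //; apply/take_sorted/red_word_alternating.
have := broken_square K eu alt; rewrite sl.
rewrite -broken_lineE => ->.
have -> // : \sum_(j < i) diagram_class (red_word w) (broken K (red_word w) j) =
    \sum_(j < len w | (j < i)%N) broken_line j.
rewrite (@big_ord_widen _ _ _ i (len w) (diagram_class (red_word w) \o broken K (red_word w))).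
  by apply: eq_bigr => j _; rewrite broken_lineE.
exact/ltnW/ltn_ord.
Qed.

Definition free_map (x : {malg K[{fmonom 'I_(len w)}]}) : A :=
  lin_ext (fun m : {fmonom 'I_(len w)} => \prod_(i <- (m : seq 'I_(len w))) broken_line i) x.

Lemma free_map_is_linear : linear free_map.
Proof. exact: lin_ext_is_linear. Qed.

HB.instance Definition _ := GRing.isLinear.Build K {malg K[{fmonom 'I_(len w)}]} A *:%R
  free_map free_map_is_linear.

Lemma free_mapP a x y : free_map (a *: x + y) = a *: free_map x + free_map y.
Proof. exact: linearP. Qed.

Lemma free_mapZ a x : free_map (a *: x) = a *: free_map x.
Proof. exact: linearZ. Qed.

Lemma free_mapU m : free_map << m >> = \prod_(i <- (m : seq 'I_(len w))) broken_line i.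
Proof. exact: lin_extU. Qed.

Lemma free_map1 : free_map 1 = 1.
Proof. by rewrite free_mapU fm1 big_nil. Qed.

Lemma free_mapM x y : free_map (x * y) = free_map x * free_map y.
Proof.
have scaleAr := @pres_scalerAr _ _ (@graph_rel K (red_word w)) (@malg_scalerAr _ _).
have monM k z : free_map (<< k >> * z) = free_map << k >> * free_map z.
  have UM j : free_map (<< k >> * << j >>) = free_map << k >> * free_map << j >>.
    by rewrite malgUM !free_mapU fmM big_cat.
  elim/malg_ind: z => [|b j z ih]; first by rewrite mulr0 linear0 mulr0.
  rewrite mulrDr malg_scalerAr !free_mapP [RHS]mulrDr scaleAr.
  exact: (congr2 (fun u v => b *: u + v) (UM j) ih).
elim/malg_ind: x => [|a k x ih]; first by rewrite mul0r linear0 mul0r.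
rewrite mulrDl -scalerAl !free_mapP [RHS]mulrDl -pres_scalerAl.
exact: (congr2 (fun u v => a *: u + v) (monM k y) ih).
Qed.

Lemma free_map_dvar i : free_map (dvar K i) = broken_line i.
Proof. by rewrite free_mapU fmU big_seq1. Qed.

Lemma free_map_rel x y : DL_rel x y -> free_map x = free_map y.
Proof.
have mul_dvar i j : free_map (dvar K i * dvar K j) = broken_line i * broken_line j.
  by rewrite free_mapM !free_map_dvar.
case=> {x y} [i j|i i0|i i0]; last 2 first.
- rewrite expr2 mul_dvar -expr2 broken_line_square free_mapZ free_mapM free_map_dvar.
  rewrite (_ : free_map (\sum_(j < len w | (j < i)%N) _) =
             \sum_(j < len w | (j < i)%N) broken_line j) //.
  by rewrite linear_sum; apply: eq_bigr => j _; exact: free_map_dvar.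
- rewrite expr2 mul_dvar -expr2 broken_line_square linear0.
  by rewrite big1 ?mulr0 ?scaler0 // => j; rewrite i0.
exact: etrans (mul_dvar i j) (etrans (broken_line_comm i j) (esym (mul_dvar j i))).
Qed.

Lemma free_map_ideal x : rel_ideal (@DL_rel K (len w)) x -> free_map x = 0.
Proof.
elim=> {x} [x y /free_map_rel h||x y _ hx _ hy|a x _ hx|x a _ hx].
- by rewrite linearB /= h subrr.
- exact: linear0.
- by rewrite linearD /= hx hy addr0.
- by rewrite free_mapM hx mulr0.
by rewrite free_mapM hx mul0r.
Qed.

Definition DLmap (x : D) : A := free_map (repr x).

Lemma DLmap_class x : DLmap (pres_class (@DL_rel K (len w)) x) = free_map x.
Proof.
apply/eqP; rewrite -subr_eq0 -[_ - _](linearB free_map); apply/eqP.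
exact/free_map_ideal/pres_repr.
Qed.

Lemma DLmap_is_linear : linear DLmap.
Proof.
move=> a x y; elim/pres_ind: x => x; elim/pres_ind: y => y.
by rewrite -pres_class_scale -pres_classD !DLmap_class linearP.
Qed.

HB.instance Definition _ := GRing.isLinear.Build K D A *:%R DLmap DLmap_is_linear.

Lemma DLmap_is_monoid_morphism : GRing.monoid_morphism DLmap.
Proof.
split=> [|x y]; first by rewrite DLmap_class free_map1.
elim/pres_ind: x => x; elim/pres_ind: y => y.
by rewrite -pres_class_mul !DLmap_class free_mapM.
Qed.

HB.instance Definition _ := GRing.isMonoidMorphism.Build D A DLmap DLmap_is_monoid_morphism.

Lemma DLmap_mon S : DLmap (DLmon K S) = Bn K S.
Proof.
rewrite rmorph_prod; apply: eq_bigr => i _; rewrite rmorphXn /=.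
by rewrite DLmap_class free_map_dvar.
Qed.

Lemma DLmap_sum (a : {ffun 'I_(len w) -> bool} -> K) :
  DLmap (\sum_S a S *: DLmon K S) = \sum_S a S *: (Bn K S : A).
Proof. by rewrite linear_sum; apply: eq_bigr => S _; rewrite linearZ /= DLmap_mon. Qed.

Lemma DLmap_inj : injective DLmap.
Proof.
suff ker x : DLmap x = 0 -> x = 0.
  move=> x y e; apply/eqP; rewrite -subr_eq0; apply/eqP/ker.
  by rewrite linearB /= e subrr.
(* Independence of the images forces all coefficients of a kernel element to vanish, whether or not
   the monomials are already known to be independent. *)
have [a ->] := DLmon_span x; rewrite DLmap_sum => /Bn_lin_indep a0.
by rewrite big1 // => S _; rewrite a0 scale0r.
Qed.

Lemma DLsubP y : DLsub y <-> exists x, DLmap x = y.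
Proof.
split=> [[a ->]|[x <-]]; first by exists (\sum_S a S *: DLmon K S); exact: DLmap_sum.
by have [a ->] := DLmon_span x; exists a; exact: DLmap_sum.
Qed.

End DotLineMorphism.

Theorem theorem3p6 (R : realType) (w : W) (hw : (1 <= len w)%N) :
  [/\ lin_indep (@Bn R[i] w),
      has_dim (@DLsub R[i] w) (2 ^ len w)
    & exists f : DL R[i] (len w) -> Aw R[i] w,
        [/\ linear f, GRing.monoid_morphism f, injective f
          & forall y, DLsub y <-> exists x, f x = y] ].
Proof.
have dim : #|{ffun 'I_(len w) -> bool}| = (2 ^ len w)%N by rewrite card_ffun card_bool card_ord.
split.
- exact: Bn_lin_indep.
- by rewrite -dim; apply/has_dim_span/Bn_lin_indep.
exists (@DLmap _ w); split.
- exact: DLmap_is_linear.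
- exact: DLmap_is_monoid_morphism.
- exact: DLmap_inj.
exact: DLsubP.
Qed.
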